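(* Let $r\in[0,1]$, let $\alpha:(a,b)\to\mathbb{R}$ be strictly increasing, let $\beta\in \mathrm{BV}_{\rm loc}((a,b),\mathbb{R})$, and assume $\theta_{1-r}(x)\neq0$ and $\theta_{r}(x)\neq0$ for all $x\in(a,b)$. Let $u$ and $v$ be linearly independent real-valued $r$-balanced solutions of $-d(dy/d\alpha)+y\,d\beta=0$ on $(a,b)$. Let $s<t$ be consecutive points in $\mathcal{Z}_{(a,b)}(u)$ such that $\theta>0$ on $(s,t)$. Then: (1) If $u^-(s)u^+(s)<0$, $u^-(t)=0$, and $\theta_{r}(s)>0$, then $v$ changes sign in $[s,t)$. (2) If $u^+(s)=0$, $u^-(t)u^+(t)<0$, and $\theta_{1-r}(t)>0$, then $v$ changes sign in $(s,t]$. (3) If $u^-(s)u^+(s)<0$, $u^+(t)=0$, and $\theta_{r}(s)\theta_{1-r}(t)>0$, then $v$ changes sign in $[s,t]$. (4) If $u^-(s)=0$, $u^-(t)u^+(t)<0$, and $\theta_{r}(s)\theta_{1-r}(t)>0$, then $v$ changes sign in $[s,t]$. (5) If $u^-(s)u^+(s)<0$, $u^-(t)u^+(t)<0$, and $\theta_{r}(s)\theta_{1-r}(t)>0$, then $v$ changes sign in $[s,t]$.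
   Context: Throughout $-\infty\le a<b\le\infty$. $\mathrm{BV}_{\rm loc}((a,b),\mathbb{C})$ (resp. $\mathrm{BV}_{\rm loc}((a,b),\mathbb{R})$) is the space of complex-valued (resp. real-valued) functions of locally bounded variation on $(a,b)$. For such $f$: $f^-(x)=\lim_{t\uparrow x}f(t)$, $f^+(x)=\lim_{t\downarrow x}f(t)$; $df$ is the locally finite complex Borel measure on $(a,b)$ generated by $f$ (so $df([x,y))=f^-(y)-f^-(x)$ for $x<y$ in $(a,b)$); $\Delta_{df}(x)=df(\{x\})=f^+(x)-f^-(x)$. For $h$ locally integrable with respect to the total variation of $df$, $h\,df$ is the measure with density $h$ with respect to $df$. For $z\in\mathbb{C}$, $\theta_z(x)=1-z^2\Delta_{d\alpha}(x)\Delta_{d\beta}(x)$, and $\theta(x)=\theta_r(x)/\theta_{1-r}(x)$, $x\in(a,b)$. A function $f$ is $r$-balanced if $f\in \mathrm{BV}_{\rm loc}((a,b),\mathbb{C})$ and $f(x)=rf^-(x)+(1-r)f^+(x)$ for all $x\in(a,b)$. A function $u$ is an $r$-balanced solution of $-d(dy/d\alpha)+y\,d\beta=0$ on $(a,b)$ if $u$ is $r$-balanced, $du\ll d\alpha$ (locally), the Radon–Nikodym derivative $du/d\alpha$ is $r$-balanced (i.e. has an $r$-balanced representative, which is then unique because $\alpha$ is strictly increasing, and $du/d\alpha$ denotes that representative), and $-d(du/d\alpha)+u\,d\beta=0$ as measures. For $f\in \mathrm{BV}_{\rm loc}((a,b),\mathbb{R})$ and a subinterval $I\subset(a,b)$,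 $\mathcal{Z}_I(f)=\{x\in I: f^-(x)f^+(x)\le0\}$. Points $s<t$ of $\mathcal{Z}_{(a,b)}(u)$ are consecutive if $\mathcal{Z}_{(a,b)}(u)\cap(s,t)=\emptyset$. A nontrivial real-valued $r$-balanced solution $w$ changes sign at $x_0\in(a,b)$ if there is $\delta>0$ such that $w^-<0$ on $(x_0-\delta,x_0)$ and $w^+>0$ on $(x_0,x_0+\delta)$, or $w^->0$ on $(x_0-\delta,x_0)$ and $w^+<0$ on $(x_0,x_0+\delta)$. It changes sign in a subinterval $I$ of $(a,b)$ if it changes sign at some point of $I$. *)

(* Defs.v *)
From HB Require Import structures.
From mathcomp Require Import all_boot all_order all_algebra.
From mathcomp Require Import all_classical all_reals all_analysis.

Set Implicit Arguments.
Unset Strict Implicit.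
Unset Printing Implicit Defensive.

Import Order.TTheory GRing.Theory Num.Theory.
Import numFieldNormedType.Exports.

Local Open Scope classical_set_scope.
Local Open Scope ring_scope.

(* A function on (a,b) is represented by a total function R -> R; nothing
   below depends on its values outside (a,b), because one-sided limits are only
   taken at points of (a,b). *)
Definition ooE (R : realType) (a b : \bar R) : set R :=
  [set x | (a < x%:E)%E /\ (x%:E < b)%E].

Definition llim (R : realType) (f : R -> R) (x : R) : R :=
  lim (f t @[t --> x^'-]).

Definition rlim (R : realType) (f : R -> R) (x : R) : R :=
  lim (f t @[t --> x^'+]).

Definition jump (R : realType) (f : R -> R) (x : R) : R :=
  rlim f x - llim f x.

Definition BVloc (R : realType) (a b : \bar R) (f : R -> R) : Prop :=
  forall c d : R, ooE a b c -> ooE a b d -> c <= d -> bounded_variation c d f.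

Definition strictly_increasing (R : realType) (a b : \bar R) (f : R -> R) :
    Prop :=
  forall x y : R, ooE a b x -> ooE a b y -> x < y -> f x < f y.

(* Locally finite signed Borel measures on (a,b), given by their Jordan
   decomposition: [lpos] and [lneg] are mutually singular positive measures,
   finite on compact subsets of (a,b). They are Borel measures on the line
   carried by (a,b). *)
Record lmeasure (R : realType) (a b : \bar R) := LMeasure {
  lpos : {measure set (measurableTypeR R) -> \bar R} ;
  lneg : {measure set (measurableTypeR R) -> \bar R} ;
  lpos_carrier : lpos (~` ooE a b) = 0%E ;
  lneg_carrier : lneg (~` ooE a b) = 0%E ;
  lpos_locally_finite : forall c d : R,
    ooE a b c -> ooE a b d -> (lpos `[c, d]%classic < +oo)%E ;
  lneg_locally_finite : forall c d : R,
    ooE a b c -> ooE a b d -> (lneg `[c, d]%classic < +oo)%E ;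
  ljordan : exists N : set (measurableTypeR R),
    [/\ measurable N, lpos (~` N) = 0%E & lneg N = 0%E]
}.

Section lmeasure_theory.
Context (R : realType) (a b : \bar R).
Implicit Types (mu nu : lmeasure a b) (f h : R -> R).

Definition lvar mu : {measure set (measurableTypeR R) -> \bar R} :=
  measure_add (lpos mu) (lneg mu).

(* The sets on which locally finite signed measures are evaluated and
   compared; on the other Borel sets [lval] may be the indeterminate
   difference of two infinite values. *)
Definition bounded_borel (E : set (measurableTypeR R)) : Prop :=
  measurable E /\
  exists c d : R, [/\ ooE a b c, ooE a b d & E `<=` `[c, d]%classic].

Definition lval mu (E : set (measurableTypeR R)) : \bar R :=
  (lpos mu E - lneg mu E)%E.

Definition lintegral mu h (E : set (measurableTypeR R)) : \bar R :=
  (\int[lpos mu]_(x in E) (h x)%:E - \int[lneg mu]_(x in E) (h x)%:E)%E.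

Definition lintegrable mu h : Prop :=
  forall c d : R, ooE a b c -> ooE a b d ->
    (lvar mu).-integrable `[c, d]%classic (EFin \o h).

(* [generates f mu] says that mu is the measure df. It determines mu, since the
   intervals [x,y) form a pi-system generating the Borel sets of (a,b). *)
Definition generates f mu : Prop :=
  forall x y : R, ooE a b x -> ooE a b y -> x < y ->
    lval mu `[x, y[%classic = (llim f y - llim f x)%:E.

(* h is a version of the Radon-Nikodym derivative dnu/dmu. *)
Definition is_RN_derivative nu mu h : Prop :=
  [/\ lvar nu `<< lvar mu,
      lintegrable mu h &
      forall E, bounded_borel E -> lval nu E = lintegral mu h E].

End lmeasure_theory.

Definition theta (R : realType) (alpha beta : R -> R) (z x : R) : R :=
  1 - z ^+ 2 * jump alpha x * jump beta x.

Definition theta_ratio (R : realType) (r : R) (alpha beta : R -> R) (x : R) :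
    R :=
  theta alpha beta r x / theta alpha beta (1 - r) x.

Definition balanced (R : realType) (a b : \bar R) (r : R) (f : R -> R) : Prop :=
  BVloc a b f /\
  forall x : R, ooE a b x -> f x = r * llim f x + (1 - r) * rlim f x.

(* Here g is the r-balanced representative of du/dalpha, and da, db, du, dg are
   the measures generated by alpha, beta, u, g. For real u this representative
   is real, so no complex-valued functions are needed. *)
Definition balanced_solution (R : realType) (a b : \bar R) (r : R)
    (alpha beta u : R -> R) : Prop :=
  balanced a b r u /\
  exists (g : R -> R) (da db du dg : lmeasure a b),
    [/\ generates alpha da, generates beta db, generates u du &
        generates g dg] /\
    [/\ balanced a b r g,
        is_RN_derivative du da g,
        lintegrable db u &
        forall E, bounded_borel a b E ->
          (- lval dg E + lintegral db u E = 0)%E].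

Definition lin_indep (R : realType) (a b : \bar R) (u v : R -> R) : Prop :=
  forall c1 c2 : R,
    (forall x : R, ooE a b x -> c1 * u x + c2 * v x = 0) -> c1 = 0 /\ c2 = 0.

Definition zeros (R : realType) (I : set R) (f : R -> R) : set R :=
  [set x | I x /\ llim f x * rlim f x <= 0].

Definition consecutive_zeros (R : realType) (a b : \bar R) (u : R -> R)
    (s t : R) : Prop :=
  [/\ zeros (ooE a b) u s, zeros (ooE a b) u t, s < t &
      zeros (ooE a b) u `&` `]s, t[%classic = set0].

Definition changes_sign_at (R : realType) (a b : \bar R) (w : R -> R) (x0 : R) :
    Prop :=
  ooE a b x0 /\
  exists delta : R,
    [/\ 0 < delta, `]x0 - delta, x0 + delta[%classic `<=` ooE a b &
        ((forall x, x \in `]x0 - delta, x0[ -> llim w x < 0) /\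
         (forall x, x \in `]x0, x0 + delta[ -> 0 < rlim w x)) \/
        ((forall x, x \in `]x0 - delta, x0[ -> 0 < llim w x) /\
         (forall x, x \in `]x0, x0 + delta[ -> rlim w x < 0))].

Definition changes_sign_in (R : realType) (a b : \bar R) (w : R -> R)
    (I : set R) : Prop :=
  exists2 x0 : R, I x0 & changes_sign_at a b w x0.

(* Main.v *)
(* The jump relations of an r-balanced solution u with g = du/dalpha say that
   the values (u, g) at x determine both one-sided limits; the Wronskian
   W = u h - g v of two solutions therefore satisfies W^+ = theta_r W and
   W^- = theta_(1-r) W. Uniqueness for the initial value problem gives W <> 0,
   so W^+ and W^- keep one sign on [s, t) and (s, t], where theta > 0.
   Normalize to u > 0 and W^+, W^- > 0 on (s, t). If v^+(x) = 0 then
   h^+(x) > 0 and v is positive just to the right of x; if v^-(x) = 0 then v is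
   negative just to the left. Hence, unless v changes sign inside (s, t), its
   sign to the right of s agrees with its sign to the left of t. The signs of v
   on the outer sides of s and t come from
   u^- v^+ - u^+ v^- = (jump of alpha) * W. *)
Require Import Defs.
From mathcomp Require Import all_boot all_order all_algebra.
From mathcomp Require Import all_classical all_reals all_analysis.
From mathcomp Require Import measurable_realfun ring lra.
Import Order.TTheory GRing.Theory Num.Theory.
Import numFieldNormedType.Exports.
Set Implicit Arguments.
Unset Strict Implicit.
Unset Printing Implicit Defensive.
Local Open Scope classical_set_scope.
Local Open Scope ring_scope.

(** * One-sided limits *)

Section one_sided_limits.
Context (R : realType).
Implicit Types (a b : \bar R) (f g : R -> R) (x y z : R).

(** Uniqueness rests on a contraction: where dalpha and dbeta each have variation at most 1/2 on an
    open interval, and (u, g) has zero data at one end, any bound on (u, g) can be halved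
    repeatedly. Atoms may be large, so this smallness is available only on open intervals next to a
    point; crossing a point is a separate algebraic step, possible because theta_r and theta_(1-r)
    do not vanish. For this reason interval statements run from the right limit at the left end to
    the left limit at the right end, and are glued at interior points, where the jump has to be
    accounted for. *)

Definition regulated a b f := forall x, ooE a b x ->
  cvg (f t @[t --> x^'-]) /\ cvg (f t @[t --> x^'+]).

Lemma ooE_itv a b x y z : ooE a b x -> ooE a b y -> x <= z -> z <= y ->
  ooE a b z.
Proof.
move=> [ax _] [_ yb] xz zy; split.
  by rewrite (lt_le_trans ax)// lee_fin.
by rewrite (le_lt_trans _ yb)// lee_fin.
Qed.

Lemma ooE_lt a b x : ooE a b x -> exists2 c, ooE a b c & c < x.
Proof.
move=> [+ xb]; case: a => [a| |]//=.
- rewrite lte_fin => ax; exists ((a + x) / 2); last by lra.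
  by split; [rewrite lte_fin; lra|rewrite (le_lt_trans _ xb)// lee_fin; lra].
- move=> _; exists (x - 1); last by lra.
  by split; [rewrite ltNyr|rewrite (le_lt_trans _ xb)// lee_fin; lra].
Qed.

Lemma ooE_gt a b x : ooE a b x -> exists2 c, ooE a b c & x < c.
Proof.
move=> [ax]; case: b => [b| |]//=.
- rewrite lte_fin => xb; exists ((b + x) / 2); last by lra.
  by split; [rewrite (lt_le_trans ax)// lee_fin; lra|rewrite lte_fin; lra].
- move=> _; exists (x + 1); last by lra.
  by split; [rewrite (lt_le_trans ax)// lee_fin; lra|rewrite ltry].
Qed.

Lemma at_right_exists x (P : R -> Prop) : (\forall y \near x^'+, P y) ->
  exists2 d, 0 < d & forall y, x < y -> y < x + d -> P y.
Proof.
move=> /nbhs_ballP[d /= d0 H]; exists d => // y xy yd; apply: H => //=.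
by rewrite /ball/= ltr_norml; lra.
Qed.

Lemma at_left_exists x (P : R -> Prop) : (\forall y \near x^'-, P y) ->
  exists2 d, 0 < d & forall y, x - d < y -> y < x -> P y.
Proof.
move=> /nbhs_ballP[d /= d0 H]; exists d => // y xy yd; apply: H => //=.
by rewrite /ball/= ltr_norml; lra.
Qed.

Lemma exists_between_right x y d : x < y -> 0 < d ->
  exists z, [/\ x < z, z < x + d & z < y].
Proof.
move=> xy d0; pose z : R := Num.min (x + d / 2) ((x + y) / 2).
by exists z; rewrite /z; split;
  rewrite ?lt_min ?gt_min; [apply/andP; split|apply/orP; left|apply/orP; right];
  lra.
Qed.

Lemma exists_between_left x y d : x < y -> 0 < d ->
  exists z, [/\ y - d < z, z < y & x < z].
Proof.
move=> xy d0; have [z [yz zd zx]] := exists_between_right (x := - y) (y := - x)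
  ltac:(by rewrite ltrN2) d0.
by exists (- z); split; lra.
Qed.

Context (a b : \bar R).

Lemma rlim_dist f x e : regulated a b f -> ooE a b x -> 0 < e ->
  exists2 d, 0 < d & forall y, x < y -> y < x + d -> `|f y - rlim f x| < e.
Proof.
move=> rf abx e0; apply: at_right_exists.
have [_ /cvgrPdist_lt/(_ e e0)] := rf x abx.
by apply: filterS => y; rewrite distrC.
Qed.

Lemma llim_dist f x e : regulated a b f -> ooE a b x -> 0 < e ->
  exists2 d, 0 < d & forall y, x - d < y -> y < x -> `|f y - llim f x| < e.
Proof.
move=> rf abx e0; apply: at_left_exists.
have [/cvgrPdist_lt/(_ e e0) + _] := rf x abx.
by apply: filterS => y; rewrite distrC.
Qed.

Lemma rlim_le f x y M : regulated a b f -> ooE a b x -> x < y ->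
  (forall z, x < z -> z < y -> f z <= M) -> rlim f x <= M.
Proof.
move=> rf abx xy H; apply: limr_le; first by have [] := rf x abx.
near=> z; apply: H; first by near: z; exact: nbhs_right_gt.
by near: z; exact: nbhs_right_lt.
Unshelve. all: by end_near. Qed.

Lemma rlim_ge f x y M : regulated a b f -> ooE a b x -> x < y ->
  (forall z, x < z -> z < y -> M <= f z) -> M <= rlim f x.
Proof.
move=> rf abx xy H; apply: limr_ge; first by have [] := rf x abx.
near=> z; apply: H; first by near: z; exact: nbhs_right_gt.
by near: z; exact: nbhs_right_lt.
Unshelve. all: by end_near. Qed.

Lemma llim_le f x y M : regulated a b f -> ooE a b y -> x < y ->
  (forall z, x < z -> z < y -> f z <= M) -> llim f y <= M.
Proof.
move=> rf abx xy H; apply: limr_le; first by have [] := rf y abx.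
near=> z; apply: H; first by near: z; exact: nbhs_left_gt.
by near: z; exact: nbhs_left_lt.
Unshelve. all: by end_near. Qed.

Lemma llim_ge f x y M : regulated a b f -> ooE a b y -> x < y ->
  (forall z, x < z -> z < y -> M <= f z) -> M <= llim f y.
Proof.
move=> rf abx xy H; apply: limr_ge; first by have [] := rf y abx.
near=> z; apply: H; first by near: z; exact: nbhs_left_gt.
by near: z; exact: nbhs_left_lt.
Unshelve. all: by end_near. Qed.

Lemma rlimD c1 c2 f g x : regulated a b f -> regulated a b g -> ooE a b x ->
  rlim (fun y => c1 * f y + c2 * g y) x = c1 * rlim f x + c2 * rlim g x.
Proof.
move=> rf rg abx; apply: cvg_lim => //.
by apply: cvgD; apply: cvgMr; [have [] := rf x abx|have [] := rg x abx].
Qed.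

Lemma llimD c1 c2 f g x : regulated a b f -> regulated a b g -> ooE a b x ->
  llim (fun y => c1 * f y + c2 * g y) x = c1 * llim f x + c2 * llim g x.
Proof.
move=> rf rg abx; apply: cvg_lim => //.
by apply: cvgD; apply: cvgMr; [have [] := rf x abx|have [] := rg x abx].
Qed.

Lemma regulatedD c1 c2 f g : regulated a b f -> regulated a b g ->
  regulated a b (fun y => c1 * f y + c2 * g y).
Proof.
move=> rf rg x abx; have [? ?] := rf x abx; have [? ?] := rg x abx.
by split; apply: is_cvgD; apply: is_cvgM => //; exact: is_cvg_cst.
Qed.

Lemma rlimM f g x : regulated a b f -> regulated a b g -> ooE a b x ->
  rlim (fun y => f y * g y) x = rlim f x * rlim g x.
Proof.
move=> rf rg abx; apply: cvg_lim => //.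
by apply: cvgM; [have [] := rf x abx|have [] := rg x abx].
Qed.

Lemma llimM f g x : regulated a b f -> regulated a b g -> ooE a b x ->
  llim (fun y => f y * g y) x = llim f x * llim g x.
Proof.
move=> rf rg abx; apply: cvg_lim => //.
by apply: cvgM; [have [] := rf x abx|have [] := rg x abx].
Qed.

Lemma regulatedM f g : regulated a b f -> regulated a b g ->
  regulated a b (fun y => f y * g y).
Proof.
move=> rf rg x abx; have [? ?] := rf x abx; have [? ?] := rg x abx.
by split; apply: is_cvgM.
Qed.

(* Compactness of [c, d] packaged as an induction on interval relations. *)
Lemma interval_chain (P : R -> R -> Prop) c d : c < d ->
  (forall x y z, c <= x -> x < y -> y < z -> z <= d -> P x y -> P y z ->
     P x z) ->
  (forall x, c <= x -> x < d -> exists2 e, 0 < e &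
     forall y, x < y -> y < x + e -> y <= d -> P x y) ->
  (forall x, c < x -> x <= d -> exists2 e, 0 < e &
     forall y, x - e < y -> y < x -> c <= y -> P y x) ->
  P c d.
Proof.
move=> cd tr Pr Pl.
pose S := [set x | c < x /\ x <= d /\ P c x].
have [e e0 He] := Pr c (lexx c) cd.
have inS y : c < y -> y < c + e -> y <= d -> S y.
  by move=> *; split => //; split => //; exact: He.
have [y0 Sy0] : S !=set0.
  exists (Num.min d (c + e / 2)).
  apply: inS; last by rewrite ge_min lexx.
    by rewrite lt_min cd/=; lra.
  by rewrite gt_min; apply/orP; right; lra.
have ubS : ubound S d by move=> x [_ []].
have hS : has_sup S by split; [exists y0|exists d].
have sd : sup S <= d by apply: ge_sup => //; exists y0.
have cs : c < sup S.
  by case: (Sy0) => cy0 _; exact: lt_le_trans cy0 (ub_le_sup hS.2 Sy0).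
have [e1 e10 He1] := Pl _ cs sd.
have [x Sx xs] := sup_adherent e10 hS.
have Pcs : P c (sup S).
  have : x <= sup S by exact: ub_le_sup hS.2 _ Sx.
  rewrite le_eqVlt => /orP[/eqP <-|xs']; first by case: Sx => _ [].
  case: Sx => cx [xd Pcx]; apply: (tr c x) => //.
  by apply: He1 => //; exact: ltW.
move: sd; rewrite le_eqVlt => /orP[/eqP <-//|sd].
have [e2 e20 He2] := Pr _ (ltW cs) sd.
pose y := Num.min d (sup S + e2 / 2).
have sy : sup S < y by rewrite lt_min sd/=; lra.
have yd : y <= d by rewrite ge_min lexx.
have Sy : S y.
  split; first exact: lt_trans sy.
  split=> //; apply: (tr c (sup S)) => //.
  by apply: He2 => //; rewrite gt_min; apply/orP; right; lra.
by have := ub_le_sup hS.2 Sy; rewrite leNgt sy.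
Qed.

End one_sided_limits.

(** * Functions of bounded variation *)

Section bounded_variation_limits.
Context (R : realType).
Implicit Types (a b : \bar R) (f g B : R -> R) (x y z c d : R).

Lemma monotone_regulated a b f :
  (forall x y, ooE a b x -> ooE a b y -> x <= y -> f x <= f y) ->
  regulated a b f.
Proof.
move=> ndf x abx.
have [c abc cx] := ooE_lt abx; have [d abd xd] := ooE_gt abx.
have itv z : c <= z -> z <= d -> ooE a b z by exact: ooE_itv.
split.
- apply: nondecreasing_at_left_is_cvgr.
    near=> y => p q; rewrite !in_itv/= => /andP[yp px] /andP[yq qx] pq.
    have cy : c < y by near: y; exact: nbhs_left_gt.
    by apply: ndf => //; apply: itv; lra.
  near=> y; exists (f x) => _ /= [p + <-]; rewrite in_itv/= => /andP[yp px].
  have cy : c < y by near: y; exact: nbhs_left_gt.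
  by apply: ndf => //; [apply: itv|apply: ltW]; lra.
- apply: nondecreasing_at_right_is_cvgr.
    near=> y => p q; rewrite !in_itv/= => /andP[xp py] /andP[xq qy] pq.
    have cy : y < d by near: y; exact: nbhs_right_lt.
    by apply: ndf => //; apply: itv; lra.
  near=> y; exists (f x) => _ /= [p + <-]; rewrite in_itv/= => /andP[xp py].
  have cy : y < d by near: y; exact: nbhs_right_lt.
  by apply: ndf => //; [apply: itv|apply: ltW]; lra.
Unshelve. all: by end_near. Qed.

Lemma bounded_variation_majorant f c d : c <= d -> bounded_variation c d f ->
  exists B, forall x y, c <= x -> x <= y -> y <= d ->
    `|f y - f x| <= B y - B x.
Proof.
move=> cd bvf; exists (fun x => fine (total_variation c x f)) => x y cx xy yd.
have fin p q : c <= p -> p <= q -> q <= d ->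
    total_variation p q f \is a fin_num.
  move=> cp pq qd; apply/bounded_variationP => //.
  apply: (bounded_variationl pq qd); apply: (bounded_variationr cp _ bvf).
  exact: le_trans qd.
have cy := le_trans cx xy; have xd := le_trans xy yd.
rewrite (total_variationD f cx xy) fineD ?fin// [leRHS]addrC addKr.
by rewrite -lee_fin fineK ?fin// total_variation_ge.
Qed.

(** Jordan decomposition: [B] and [B + f] are nondecreasing and [f] is their difference, so all
    one-sided limits exist. *)
Lemma regulated_majorant a b f B :
  (forall x y, ooE a b x -> ooE a b y -> x <= y -> `|f y - f x| <= B y - B x) ->
  regulated a b f /\ regulated a b B.
Proof.
move=> H.
have rB : regulated a b B.
  apply: monotone_regulated => x y abx aby xy.
  by rewrite -subr_ge0 (le_trans _ (H _ _ abx aby xy)).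
split=> //.
have rD : regulated a b (fun y => 1 * B y + 1 * f y).
  apply: monotone_regulated => x y abx aby xy.
  by have := H _ _ abx aby xy; rewrite ler_norml => /andP[]; lra.
rewrite (_ : f = fun y => 1 * (1 * B y + 1 * f y) + (- 1) * B y).
  exact: regulatedD.
by apply/funext => y; lra.
Qed.

Lemma ooE_EFin c d x : ooE c%:E d%:E x <-> c < x /\ x < d.
Proof. by rewrite /ooE/= !lte_fin. Qed.

(** The interior of the compact interval is presented as [ooE c%:E d%:E], so that results stated for
    [ooE] apply to it as an interval in its own right. *)
Lemma BVloc_majorant a b f c d : BVloc a b f -> ooE a b c -> ooE a b d ->
  c <= d -> exists B, forall x y, ooE c%:E d%:E x -> ooE c%:E d%:E y ->
    x <= y -> `|f y - f x| <= B y - B x.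
Proof.
move=> bvf abc abd cd.
have [B HB] := bounded_variation_majorant cd (bvf _ _ abc abd cd).
exists B => x y /ooE_EFin[cx _] /ooE_EFin[_ yd] xy; exact: HB (ltW _) _ (ltW _).
Qed.

Lemma BVloc_regulated a b f : BVloc a b f -> regulated a b f.
Proof.
move=> bvf x abx.
have [c abc cx] := ooE_lt abx; have [d abd xd] := ooE_gt abx.
have [B HB] := BVloc_majorant bvf abc abd (ltW (lt_trans cx xd)).
by have [+ _] := regulated_majorant HB; apply; apply/ooE_EFin.
Qed.

Lemma regulated_cst a b k : regulated a b (fun=> k).
Proof. by move=> x _; split; exact: is_cvg_cst. Qed.

(** The measure dB dominates |df| on open subintervals of [c, d] and at points of (c, d). Atoms at c
    and d are left out, to match increments from [rlim] at c to [llim] at d. *)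
Definition majorizes c d B f :=
  (forall x y, c <= x -> x < y -> y <= d ->
    `|llim f y - rlim f x| <= llim B y - rlim B x) /\
  (forall x, c < x -> x < d -> `|jump f x| <= jump B x).

Lemma rlim_le_llim a b f x y : regulated a b f ->
  (forall x y, ooE a b x -> ooE a b y -> x <= y -> f x <= f y) ->
  ooE a b x -> ooE a b y -> x < y -> rlim f x <= llim f y.
Proof.
move=> rf ndf abx aby xy; pose m := (x + y) / 2.
have [xm my] : x < m /\ m < y by split; rewrite /m; lra.
have abm : ooE a b m by apply: ooE_itv abx aby _ _; exact: ltW.
apply: (@le_trans _ _ (f m)).
  apply: (rlim_le rf abx xm) => z xz zm; apply: ndf => //; last exact: ltW.
  by apply: ooE_itv abx abm _ _; exact: ltW.
apply: (llim_ge rf aby my) => z mz zy; apply: ndf => //; last exact: ltW.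
by apply: ooE_itv abm aby _ _; exact: ltW.
Qed.

Lemma llim_le_rlim a b f x : regulated a b f ->
  (forall x y, ooE a b x -> ooE a b y -> x <= y -> f x <= f y) ->
  ooE a b x -> llim f x <= rlim f x.
Proof.
move=> rf ndf abx.
have [c abc cx] := ooE_lt abx; have [d abd xd] := ooE_gt abx.
apply: (@le_trans _ _ (f x)).
  apply: (llim_le rf abx cx) => z cz zx; apply: ndf => //; last exact: ltW.
  by apply: ooE_itv abc abx _ _; exact: ltW.
apply: (rlim_ge rf abx xd) => z cz zx; apply: ndf => //; last exact: ltW.
by apply: ooE_itv abx abd _ _; exact: ltW.
Qed.

Lemma majorant_majorizes a b f B c d :
  (forall x y, ooE a b x -> ooE a b y -> x <= y -> `|f y - f x| <= B y - B x) ->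
  ooE a b c -> ooE a b d -> majorizes c d B f.
Proof.
move=> H abc abd; have [rf rB] := regulated_majorant H.
have ndP : forall x y, ooE a b x -> ooE a b y -> x <= y ->
    1 * B x + 1 * f x <= 1 * B y + 1 * f y.
  move=> x y abx aby xy.
  by have := H _ _ abx aby xy; rewrite ler_norml => /andP[]; lra.
have ndN : forall x y, ooE a b x -> ooE a b y -> x <= y ->
    1 * B x + (- 1) * f x <= 1 * B y + (- 1) * f y.
  move=> x y abx aby xy.
  by have := H _ _ abx aby xy; rewrite ler_norml => /andP[]; lra.
have rP := regulatedD 1 1 rB rf; have rN := regulatedD 1 (- 1) rB rf.
split=> [x y cx xy yd|x cx xd].
  have abx : ooE a b x by apply: ooE_itv abc abd _ _ => //; lra.
  have aby : ooE a b y by apply: ooE_itv abc abd _ _ => //; lra.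
  have := rlim_le_llim rP ndP abx aby xy;
    have := rlim_le_llim rN ndN abx aby xy.
  rewrite !(llimD _ _ rB rf)// !(rlimD _ _ rB rf)// ler_norml; lra.
have abx : ooE a b x by apply: ooE_itv abc abd _ _; exact: ltW.
have := llim_le_rlim rP ndP abx; have := llim_le_rlim rN ndN abx.
by rewrite !(llimD _ _ rB rf)// !(rlimD _ _ rB rf)// /jump ler_norml; lra.
Qed.

(** The bound 1/2 is the contraction factor of the uniqueness argument. It can be reached on either
    side of every point because the atom at x itself is not counted. *)
Definition locally_small a b f := forall x, ooE a b x ->
  (exists2 e, 0 < e & forall y, x < y -> y < x + e ->
    exists2 B, majorizes x y B f & llim B y - rlim B x <= 1 / 2) /\
  (exists2 e, 0 < e & forall y, x - e < y -> y < x ->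
    exists2 B, majorizes y x B f & llim B x - rlim B y <= 1 / 2).

Lemma BVloc_locally_small a b f : BVloc a b f -> locally_small a b f.
Proof.
move=> bvf x abx.
have [c abc cx] := ooE_lt abx; have [d abd xd] := ooE_gt abx.
have [B HB] := BVloc_majorant bvf abc abd (ltW (lt_trans cx xd)).
have [_ rB] := regulated_majorant HB.
have cdx : ooE c%:E d%:E x by apply/ooE_EFin.
split.
  have [|e e0 He] := rlim_dist (e := 1 / 2) rB cdx; first lra.
  exists (Num.min e (d - x)); first by rewrite lt_min e0/= subr_gt0.
  move=> y xy; rewrite -ltrBlDl lt_min => /andP[ye yd].
  have cdy : ooE c%:E d%:E y by apply/ooE_EFin; split; lra.
  exists B; first exact: majorant_majorizes HB cdx cdy.
  rewrite lerBlDr; apply: (llim_le rB cdy xy) => z xz zy.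
  have := He z xz; rewrite ltr_norml => /(_ ltac:(lra)) /andP[]; lra.
have [|e e0 He] := llim_dist (e := 1 / 2) rB cdx; first lra.
exists (Num.min e (x - c)); first by rewrite lt_min e0/= subr_gt0.
move=> y; rewrite ltrBlDr -ltrBlDl lt_min => /andP[ye yd] yx.
have cdy : ooE c%:E d%:E y by apply/ooE_EFin; split; lra.
exists B; first exact: majorant_majorizes HB cdy cdx.
rewrite lerBlDl -lerBlDr; apply: (rlim_ge rB cdy yx) => z xz zy.
have := He z; rewrite ltr_norml => /(_ ltac:(lra) ltac:(lra)) /andP[]; lra.
Qed.

Lemma monotone_BVloc a b f :
  (forall x y, ooE a b x -> ooE a b y -> x <= y -> f x <= f y) ->
  BVloc a b f.
Proof.
move=> ndf c d abc abd cd; apply: nondecreasing_bounded_variation => x y.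
rewrite !in_itv/= => /andP[cx xd] /andP[cy yd] xy.
by apply: ndf => //; exact: ooE_itv abc abd _ _.
Qed.

End bounded_variation_limits.

(** * The relation df = g dalpha *)

Section stieltjes_derivative.
Context (R : realType) (a b : \bar R).
Implicit Types (f g al B : R -> R) (x y z c d e : R).

(* [df = g dal] expressed without measures: the jumps match, and off the jumps
   [g^+] and [g^-] are the one-sided derivatives of f with respect to al, with
   an error that is small compared with a superadditive interval function (the
   total variation of dal, in the application). Unlike the integral form, this
   is linear in (f, g) even when each f comes with its own copy of the measure
   dal. *)
Definition stieltjes_derivative f g al :=
  (forall x, ooE a b x -> jump f x = g x * jump al x) /\
  exists nu : R -> R -> R,
  [/\ (forall x y, 0 <= nu x y),
      (forall x y z, ooE a b x -> ooE a b z -> x < y -> y < z ->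
         nu x y + nu y z <= nu x z),
      (forall x, ooE a b x -> forall e, 0 < e ->
         exists2 d, 0 < d & forall y, ooE a b y -> x < y -> y < x + d ->
         `|llim f y - rlim f x - rlim g x * (llim al y - rlim al x)|
           <= e * nu x y) &
      (forall x, ooE a b x -> forall e, 0 < e ->
         exists2 d, 0 < d & forall y, ooE a b y -> x - d < y -> y < x ->
         `|llim f x - rlim f y - llim g x * (llim al x - rlim al y)|
           <= e * nu y x)].

Lemma stieltjes_derivativeD c1 c2 f1 f2 g1 g2 al :
  regulated a b f1 -> regulated a b f2 ->
  regulated a b g1 -> regulated a b g2 ->
  stieltjes_derivative f1 g1 al -> stieltjes_derivative f2 g2 al ->
  stieltjes_derivative (fun x => c1 * f1 x + c2 * f2 x)
    (fun x => c1 * g1 x + c2 * g2 x) al.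
Proof.
move=> rf1 rf2 rg1 rg2 [j1 [n1 [n10 n1D R1 L1]]] [j2 [n2 [n20 n2D R2 L2]]].
have tri (e p q X Y : R) : `|X| <= e * p -> `|Y| <= e * q ->
    `|c1 * X + c2 * Y| <= e * (`|c1| * p + `|c2| * q).
  move=> Xp Yq; apply: (le_trans (ler_normD _ _)); rewrite !normrM mulrDr.
  by apply: lerD; rewrite mulrCA ler_wpM2l.
split=> [x abx|].
  have := j1 x abx; have := j2 x abx; rewrite /jump.
  rewrite !(@llimD R a b)// !(@rlimD R a b)// => E2 E1.
  by rewrite mulrDl -!mulrA -E1 -E2; lra.
(* Each summand brings its own control function; a nonnegative combination of superadditive
   functions is superadditive. *)
exists (fun x y => `|c1| * n1 x y + `|c2| * n2 x y); split.
- by move=> x y; rewrite addr_ge0// mulr_ge0.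
- move=> x y z abx abz xy yz.
  have -> : `|c1| * n1 x y + `|c2| * n2 x y + (`|c1| * n1 y z + `|c2| * n2 y z)
    = `|c1| * (n1 x y + n1 y z) + `|c2| * (n2 x y + n2 y z) by ring.
  by apply: lerD; apply: ler_wpM2l => //; [apply: n1D|apply: n2D].
- move=> x abx e e0.
  have [d1 d10 H1] := R1 x abx e e0; have [d2 d20 H2] := R2 x abx e e0.
  exists (Num.min d1 d2); first by rewrite lt_min d10.
  move=> y aby xy; rewrite -ltrBlDl lt_min !ltrBlDl => /andP[y1 y2].
  rewrite !(@llimD R a b)// !(@rlimD R a b)//.
  have := tri _ _ _ _ _ (H1 y aby xy y1) (H2 y aby xy y2).
  apply: le_trans; rewrite le_eqVlt; apply/orP; left; apply/eqP.
  by congr `|_|; ring.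
- move=> x abx e e0.
  have [d1 d10 H1] := L1 x abx e e0; have [d2 d20 H2] := L2 x abx e e0.
  exists (Num.min d1 d2); first by rewrite lt_min d10.
  move=> y aby; rewrite ltrBlDr -ltrBlDl lt_min => /andP[y1 y2] yx.
  rewrite !(@llimD R a b)// !(@rlimD R a b)//.
  have := tri _ _ _ _ _ (H1 y aby ltac:(lra) yx) (H2 y aby ltac:(lra) yx).
  apply: le_trans; rewrite le_eqVlt; apply/orP; left; apply/eqP.
  by congr `|_|; ring.
Qed.

Lemma stieltjes_derivative_id al : stieltjes_derivative al (fun=> 1) al.
Proof.
split=> [x _|]; first by rewrite mul1r.
have r1 (x : R) : rlim (fun=> 1 : R) x = 1 by exact: lim_cst.
have l1 (x : R) : llim (fun=> 1 : R) x = 1 by exact: lim_cst.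
exists (fun _ _ => 0); split=> //.
- move=> x abx e e0; exists 1 => // y _ _ _.
  by rewrite r1 mul1r subrr normr0 mulr0.
- move=> x abx e e0; exists 1 => // y _ _ _.
  by rewrite l1 mul1r subrr normr0 mulr0.
Qed.

Lemma ler_forall_eps (X Y N : R) : 0 <= N ->
  (forall e, 0 < e -> X <= Y + e * N) -> X <= Y.
Proof.
move=> N0 H; apply/ler_addgt0Pr => e e0.
have N1 : 0 < N + 1 by lra.
apply: (le_trans (H (e / (N + 1)) _)); first exact: divr_gt0.
by rewrite lerD2l -mulrA ger_pMr// mulrC ler_pdivrMr//; lra.
Qed.

(** A mean value inequality. Locally it holds up to an error [e * nu]; gluing at y adds the jump
    [g y * jump al y], bounded in the same way, and superadditivity keeps the total error below
    [e * nu c d]. Then e tends to 0. *)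
Lemma stieltjes_derivative_le f g al B c d M :
  ooE a b c -> ooE a b d -> c < d -> regulated a b g ->
  stieltjes_derivative f g al -> majorizes c d B al -> 0 <= M ->
  (forall x, c < x -> x < d -> `|g x| <= M) ->
  `|llim f d - rlim f c| <= M * (llim B d - rlim B c).
Proof.
move=> abc abd cd rg [jf [nu [nu0 nuD Rf Lf]]] [mB jB] M0 gM.
have itv z : c <= z -> z <= d -> ooE a b z by exact: ooE_itv.
apply: (ler_forall_eps (nu0 c d)) => e e0.
pose P x y := `|llim f y - rlim f x| <= M * (llim B y - rlim B x) + e * nu x y.
apply: (@interval_chain R P) => //.
- move=> x y z cx xy yz zd; rewrite /P => Pxy Pyz.
  have [cy yd] := (le_lt_trans cx xy, lt_le_trans yz zd).
  have abx : ooE a b x := itv _ cx (ltW (lt_trans xy yd)).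
  have abz : ooE a b z := itv _ (ltW (lt_trans cy yz)) zd.
  have aby : ooE a b y := itv _ (ltW cy) (ltW yd).
  have jy : `|jump f y| <= M * jump B y.
    by rewrite jf// normrM ler_pM// ?gM// jB.
  have nuxyz : e * nu x y + e * nu y z <= e * nu x z.
    by rewrite -mulrDr ler_pM2l// nuD.
  have -> : llim f z - rlim f x = (llim f y - rlim f x) + jump f y +
    (llim f z - rlim f y) by rewrite /jump; ring.
  apply: (le_trans (ler_normD _ _)).
  apply: (le_trans (lerD (le_trans (ler_normD _ _) (lerD Pxy jy)) Pyz)).
  rewrite -(lerD2l (M * (llim B z - rlim B x))) in nuxyz.
  apply: le_trans nuxyz; rewrite le_eqVlt; apply/orP; left; apply/eqP.
  by rewrite /jump; ring.
- move=> x cx xd.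
  have abx : ooE a b x by apply: itv; lra.
  have [k k0 Hk] := Rf x abx e e0; exists k => // y xy yk yd.
  have aby : ooE a b y by apply: itv; lra.
  have gx : `|rlim g x| <= M.
    rewrite ler_norml; apply/andP; split.
      apply: (rlim_ge rg abx xd) => z xz zd.
      by have := gM z ltac:(lra) zd; rewrite ler_norml => /andP[].
    apply: (rlim_le rg abx xd) => z xz zd.
    by have := gM z ltac:(lra) zd; rewrite ler_norml => /andP[].
  rewrite /P -(subrK (rlim g x * (llim al y - rlim al x)) (llim f y - _)).
  rewrite (le_trans (ler_normD _ _))// addrC lerD ?Hk//.
  by rewrite normrM ler_pM ?mB.
- move=> x cx xd.
  have abx : ooE a b x by apply: itv; lra.
  have [k k0 Hk] := Lf x abx e e0; exists k => // y xy yk yd.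
  have aby : ooE a b y by apply: itv; lra.
  have gx : `|llim g x| <= M.
    rewrite ler_norml; apply/andP; split.
      apply: (llim_ge rg abx cx) => z xz zd.
      by have := gM z ltac:(lra) ltac:(lra); rewrite ler_norml => /andP[].
    apply: (llim_le rg abx cx) => z xz zd.
    by have := gM z ltac:(lra) ltac:(lra); rewrite ler_norml => /andP[].
  rewrite /P -(subrK (llim g x * (llim al x - rlim al y)) (llim f x - _)).
  rewrite (le_trans (ler_normD _ _))// addrC lerD ?Hk//.
  by rewrite normrM ler_pM ?mB.
Qed.

Lemma majorizes_mono al c d : strictly_increasing a b al ->
  ooE a b c -> ooE a b d -> majorizes c d al al.
Proof.
move=> sal abc abd; apply: (majorant_majorizes _ abc abd) => x y abx aby.
rewrite le_eqVlt => /orP[/eqP->|xy]; first by rewrite !subrr normr0.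
by rewrite ger0_norm// subr_ge0 ltW// sal.
Qed.

Lemma strictly_increasing_le al x y : strictly_increasing a b al ->
  ooE a b x -> ooE a b y -> x <= y -> al x <= al y.
Proof.
by move=> sal abx aby; rewrite le_eqVlt => /orP[/eqP->//|xy]; rewrite ltW// sal.
Qed.

Lemma strictly_increasing_regulated al : strictly_increasing a b al ->
  regulated a b al.
Proof.
by move=> sal; apply: monotone_regulated => x y; exact: strictly_increasing_le.
Qed.

Lemma rlim_lt_llim al x y : strictly_increasing a b al ->
  ooE a b x -> ooE a b y -> x < y -> rlim al x < llim al y.
Proof.
move=> sal abx aby xy.
have ral := strictly_increasing_regulated sal.
have le_al := fun p q => @strictly_increasing_le al p q sal.
pose m := (x + y) / 2.
have [xm my] : x < m /\ m < y by split; rewrite /m; lra.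
have abm : ooE a b m by apply: ooE_itv abx aby _ _; exact: ltW.
pose n := (m + y) / 2.
have [mn ny] : m < n /\ n < y by split; rewrite /n; lra.
have abn : ooE a b n by apply: ooE_itv abm aby _ _; exact: ltW.
have := sal _ _ abm abn mn.
have : rlim al x <= al m.
  apply: (rlim_le ral abx xm) => z xz zm; apply: le_al => //; last exact: ltW.
  by apply: ooE_itv abx abm _ _; exact: ltW.
have : al n <= llim al y.
  apply: (llim_ge ral aby ny) => z xz zm; apply: le_al => //; last exact: ltW.
  by apply: ooE_itv abn aby _ _; exact: ltW.
lra.
Qed.

Lemma strictly_increasing_jump al x : strictly_increasing a b al ->
  ooE a b x -> 0 <= jump al x.
Proof.
move=> sal abx; rewrite subr_ge0; apply: (llim_le_rlim _ _ abx).
  exact: strictly_increasing_regulated.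
by move=> y z; exact: strictly_increasing_le.
Qed.

(** This is the mean value inequality for [f - k * al], whose derivative is at most k / 2 in
    modulus: [f] grows by at least k / 2 times the positive increment of [al]. *)
Lemma stieltjes_derivative_gt0 f g al c d k : strictly_increasing a b al ->
  regulated a b f -> regulated a b g -> stieltjes_derivative f g al ->
  ooE a b c -> ooE a b d -> c < d -> 0 < k ->
  (forall x, c < x -> x < d -> `|g x - k| < k / 2) ->
  rlim f c < llim f d.
Proof.
move=> sal rf rg sd abc abd cd k0 gk.
have ral := strictly_increasing_regulated sal.
have r1 : regulated a b (fun=> 1) by exact: regulated_cst.
have sd' := stieltjes_derivativeD 1 (- k) rf ral rg r1 sd
  (stieltjes_derivative_id al).
have al0 := rlim_lt_llim sal abc abd cd.
have k20 : 0 <= k / 2 by lra.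
have := stieltjes_derivative_le abc abd cd (regulatedD 1 (- k) rg r1) sd'
  (majorizes_mono sal abc abd) k20.
have bnd : forall x, c < x -> x < d -> `|1 * g x + - k * 1| <= k / 2.
  by move=> x cx xd; rewrite mul1r mulr1 ltW// gk.
move=> /(_ bnd); rewrite !(llimD _ _ rf ral)// !(rlimD _ _ rf ral)// ler_norml.
by nra.
Qed.

(** Just to the right of x, [g] stays positive and [f] increases from 0. This gives the left limits
    at y; the right limits follow since the jump of [f] there is [g y * jump al y >= 0]. *)
Lemma rlim0_gt0_right f g al x : strictly_increasing a b al ->
  regulated a b f -> regulated a b g -> stieltjes_derivative f g al ->
  ooE a b x -> rlim f x = 0 -> 0 < rlim g x ->
  exists2 e, 0 < e & forall y, ooE a b y -> x < y -> y < x + e ->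
    0 < llim f y /\ 0 < rlim f y.
Proof.
move=> sal rf rg sd abx fx0 gx0.
have gx20 : 0 < rlim g x / 2 by lra.
have [e e0 He] := rlim_dist rg abx gx20.
exists e => // y aby xy ye.
have fy : 0 < llim f y.
  rewrite -fx0; apply: (stieltjes_derivative_gt0 sal rf rg sd abx aby xy gx0).
  by move=> z xz zy; apply: He => //; exact: lt_trans ye.
split=> //; rewrite -(subrK (llim f y) (rlim f y)).
apply: ltr_wpDl => //; case: (sd) => /(_ y aby) + _; rewrite {1}/jump => ->.
apply: mulr_ge0; last exact: strictly_increasing_jump.
by have := He y xy ye; rewrite ltr_norml => /andP[] + _; lra.
Qed.

Lemma llim0_lt0_left f g al x : strictly_increasing a b al ->
  regulated a b f -> regulated a b g -> stieltjes_derivative f g al ->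
  ooE a b x -> llim f x = 0 -> 0 < llim g x ->
  exists2 e, 0 < e & forall y, ooE a b y -> x - e < y -> y < x ->
    llim f y < 0 /\ rlim f y < 0.
Proof.
move=> sal rf rg sd abx fx0 gx0.
have gx20 : 0 < llim g x / 2 by lra.
have [e e0 He] := llim_dist rg abx gx20.
exists e => // y aby xy ye.
have fy : rlim f y < 0.
  rewrite -fx0; apply: (stieltjes_derivative_gt0 sal rf rg sd aby abx ye gx0).
  by move=> z xz zy; apply: He => //; exact: lt_trans xz.
split=> //; apply: le_lt_trans fy; rewrite -subr_ge0.
case: (sd) => /(_ y aby) + _; rewrite {1}/jump => ->.
apply: mulr_ge0; last exact: strictly_increasing_jump.
by have := He y xy ye; rewrite ltr_norml => /andP[] + _; lra.
Qed.

End stieltjes_derivative.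

(** * Uniqueness and the Wronskian *)

Section solutions.
Context (R : realType) (a b : \bar R) (r : R) (al be : R -> R).
Implicit Types (u g v h w k : R -> R) (x y z c d e M : R).

(** The first-order system du = g dalpha, dg = u dbeta, freed of measures, with both components
    r-balanced. *)
Definition solution u g :=
  [/\ regulated a b u, regulated a b g,
      (forall x, ooE a b x -> u x = r * llim u x + (1 - r) * rlim u x),
      (forall x, ooE a b x -> g x = r * llim g x + (1 - r) * rlim g x) &
      stieltjes_derivative a b u g al /\ stieltjes_derivative a b g u be].

Lemma solutionD c1 c2 u g v h : solution u g -> solution v h ->
  solution (fun x => c1 * u x + c2 * v x) (fun x => c1 * g x + c2 * h x).
Proof.
move=> [ru rg bu bg [du dg]] [rv rh bv bh [dv dh]].
split; [exact: regulatedD|exact: regulatedD| | |].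
- by move=> x abx; rewrite (@llimD R a b)// (@rlimD R a b)// bu// bv//; ring.
- by move=> x abx; rewrite (@llimD R a b)// (@rlimD R a b)// bg// bh//; ring.
- by split; exact: stieltjes_derivativeD.
Qed.

(** Balancedness splits a jump: the fraction r of it lies between the value and the right limit, the
    fraction 1 - r between the left limit and the value. *)
Lemma solution_rlim u g x : solution u g -> ooE a b x ->
  rlim u x = u x + r * jump al x * g x /\
  rlim g x = g x + r * jump be x * u x.
Proof.
move=> [_ _ bu bg [[ju _] [jg _]]] abx.
have := ju x abx; have := jg x abx.
rewrite -mulrA [jump al x * _]mulrC -[r * _ * u x]mulrA [jump be x * _]mulrC.
move=> <- <-; split; [rewrite bu|rewrite bg] => //; rewrite /jump; ring.
Qed.

Lemma solution_llim u g x : solution u g -> ooE a b x ->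
  llim u x = u x - (1 - r) * jump al x * g x /\
  llim g x = g x - (1 - r) * jump be x * u x.
Proof.
move=> [_ _ bu bg [[ju _] [jg _]]] abx.
have := ju x abx; have := jg x abx.
rewrite -mulrA [jump al x * _]mulrC -[_ * jump be x * u x]mulrA.
rewrite [jump be x * _]mulrC.
move=> <- <-; split; [rewrite bu|rewrite bg] => //; rewrite /jump; ring.
Qed.

Lemma chain_bound (p q s t A B C M : R) :
  0 <= A -> 0 <= B -> 0 <= C -> A + C + B <= M ->
  `|q - p| <= A -> `|s - q| <= C -> `|t - s| <= B ->
  p = 0 \/ t = 0 -> `|q| <= M /\ `|s| <= M.
Proof.
move=> A0 B0 C0 ABC; rewrite !ler_norml => /andP[a1 a2] /andP[c1 c2].
by move=> /andP[b1 b2] [] pt; rewrite pt in a1 a2 b1 b2 *;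
  split; apply/andP; split; lra.
Qed.

Lemma convex_bound (p q M : R) : 0 <= r -> r <= 1 ->
  `|p| <= M -> `|q| <= M -> `|r * p + (1 - r) * q| <= M.
Proof.
move=> r0 r1 pM qM; apply: (le_trans (ler_normD _ _)); rewrite !normrM.
have r1' : 0 <= 1 - r by rewrite subr_ge0.
rewrite (ger0_norm r0) (ger0_norm r1').
have -> : M = r * M + (1 - r) * M by ring.
by apply: lerD; apply: ler_wpM2l.
Qed.

(** The increments of [f] along (c, d), the jump at x included, add up to at most M / 2. As [f]
    vanishes at one end, both limits at x obey this bound, and so does their convex combination
    [f x]. *)
Lemma solution_halving f g m c d M : 0 <= r -> r <= 1 ->
  regulated a b g -> stieltjes_derivative a b f g m ->
  (forall x, ooE a b x -> f x = r * llim f x + (1 - r) * rlim f x) ->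
  (exists2 B, majorizes c d B m & llim B d - rlim B c <= 1 / 2) ->
  ooE a b c -> ooE a b d -> c < d -> 0 <= M ->
  (forall x, c < x -> x < d -> `|g x| <= M) ->
  rlim f c = 0 \/ llim f d = 0 ->
  forall x, c < x -> x < d -> `|f x| <= M / 2.
Proof.
move=> r0 r1 rg sd bf [B [mB jB] B2] abc abd cd M0 gM f0 x cx xd.
have abx : ooE a b x by apply: ooE_itv abc abd _ _; exact: ltW.
have Hl : `|llim f x - rlim f c| <= M * (llim B x - rlim B c).
  apply: (stieltjes_derivative_le abc abx cx rg sd _ M0).
    split=> [y z cy yz zx|y cy yx]; last exact: jB cy (lt_trans yx xd).
    exact: mB cy yz (le_trans zx (ltW xd)).
  by move=> y cy yx; apply: gM cy (lt_trans yx xd).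
have Hr : `|llim f d - rlim f x| <= M * (llim B d - rlim B x).
  apply: (stieltjes_derivative_le abx abd xd rg sd _ M0).
    split=> [y z cy yz zx|y cy yx]; last exact: jB (lt_trans cx cy) yx.
    exact: mB (le_trans (ltW cx) cy) yz zx.
  by move=> y cy yx; apply: gM (lt_trans cx cy) yx.
have Hj : `|rlim f x - llim f x| <= M * (rlim B x - llim B x).
  case: (sd) => jf _; have := jf x abx; rewrite {1}/jump => ->.
  by rewrite normrM ler_pM ?gM// jB.
have B1 : 0 <= M * (llim B x - rlim B c).
  by rewrite (le_trans _ Hl).
have B3 : 0 <= M * (llim B d - rlim B x).
  by rewrite (le_trans _ Hr).
have B4 : 0 <= M * (rlim B x - llim B x).
  by rewrite (le_trans _ Hj).
have MB : M * (llim B x - rlim B c) + M * (rlim B x - llim B x) +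
    M * (llim B d - rlim B x) <= M / 2.
  rewrite -!mulrDr ler_wpM2l// -[2^-1]mul1r (le_trans _ B2)//.
  by rewrite le_eqVlt; apply/orP; left; apply/eqP; ring.
have [fl fr] := chain_bound B1 B3 B4 MB Hl Hj Hr f0.
by rewrite bf//; exact: convex_bound.
Qed.

Lemma iter_halving0 (X M : R) : (forall n : nat, `|X| <= M / 2 ^+ n) -> X = 0.
Proof.
move=> H; apply/eqP; rewrite -normr_le0; apply/ler_addgt0Pr => e e0.
have h : `|1 / 2 : R| < 1 by rewrite ger0_norm; lra.
rewrite add0r; have /cvgr0Pnorm_lt/(_ e e0)[n _ Hn] := cvg_geometric M h.
have := Hn n (leqnn n); rewrite /geometric/= => Hn'.
apply: le_trans (H n) _; rewrite ltW// (le_lt_trans _ Hn')//.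
by rewrite mul1r exprVn ler_norm.
Qed.

Definition vanishes_right u g x := rlim u x = 0 /\ rlim g x = 0.
Definition vanishes_left u g x := llim u x = 0 /\ llim g x = 0.

(** Zero data at either end start the halving: since each of [u], [g] controls the other, M improves
    to M / 2 ^+ n for every n. Both functions vanish on the open interval, hence so do their limits
    at the two ends. *)
Lemma vanishes_across u g c d M : 0 <= r -> r <= 1 -> solution u g ->
  (exists2 B, majorizes c d B al & llim B d - rlim B c <= 1 / 2) ->
  (exists2 B, majorizes c d B be & llim B d - rlim B c <= 1 / 2) ->
  ooE a b c -> ooE a b d -> c < d -> 0 <= M ->
  (forall x, c < x -> x < d -> `|u x| <= M /\ `|g x| <= M) ->
  vanishes_right u g c <-> vanishes_left u g d.
Proof.
move=> r0 r1 [ru rg bu bg [du dg]] mal mbe abc abd cd M0 ugM.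
have H : vanishes_right u g c \/ vanishes_left u g d ->
    forall x, c < x -> x < d -> u x = 0 /\ g x = 0.
  move=> V.
  have Vu : rlim u c = 0 \/ llim u d = 0 by case: V => -[]; [left|right].
  have Vg : rlim g c = 0 \/ llim g d = 0 by case: V => -[]; [left|right].
  suff HM (n : nat) : forall x, c < x -> x < d ->
      `|u x| <= M / 2 ^+ n /\ `|g x| <= M / 2 ^+ n.
    by move=> x cx xd; split; apply: (@iter_halving0 _ M) => n;
      have [] := HM n x cx xd.
  elim: n => [|n IH] x cx xd; first by rewrite expr0 divr1; exact: ugM.
  have Mn : 0 <= M / 2 ^+ n by rewrite divr_ge0// exprn_ge0.
  rewrite exprSr invfM mulrA; split.
    apply: (solution_halving r0 r1 rg du bu mal abc abd cd Mn _ Vu cx xd).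
    by move=> y cy yd; have [] := IH y cy yd.
  apply: (solution_halving r0 r1 ru dg bg mbe abc abd cd Mn _ Vg cx xd).
  by move=> y cy yd; have [] := IH y cy yd.
have Z f : regulated a b f -> (forall x, c < x -> x < d -> f x = 0) ->
    rlim f c = 0 /\ llim f d = 0.
  move=> rf f0; split; apply/eqP; rewrite eq_le; apply/andP; split.
  - by apply: (rlim_le rf abc cd) => z cz zd; rewrite f0.
  - by apply: (rlim_ge rf abc cd) => z cz zd; rewrite f0.
  - by apply: (llim_le rf abd cd) => z cz zd; rewrite f0.
  - by apply: (llim_ge rf abd cd) => z cz zd; rewrite f0.
split=> V.
  have {}V := H (or_introl V).
  have [_ lu] := Z u ru (fun x p q => (V x p q).1).
  by have [_ lg] := Z g rg (fun x p q => (V x p q).2).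
have {}V := H (or_intror V).
have [lu _] := Z u ru (fun x p q => (V x p q).1).
by have [lg _] := Z g rg (fun x p q => (V x p q).2).
Qed.

Hypotheses (r0 : 0 <= r) (r1 : r <= 1).
Hypotheses (bval : BVloc a b al) (bvbe : BVloc a b be).
Hypothesis theta0 : forall x, ooE a b x ->
  theta al be (1 - r) x != 0 /\ theta al be r x != 0.

(** The linear maps from [(u x, g x)] to the right and to the left limits have determinants
    [theta al be r x] and [theta al be (1 - r) x], so both are injective. *)
Lemma vanishes_at u g x : solution u g -> ooE a b x ->
  (vanishes_right u g x <-> u x = 0 /\ g x = 0) /\
  (vanishes_left u g x <-> u x = 0 /\ g x = 0).
Proof.
move=> S abx; rewrite /vanishes_right /vanishes_left.
have [-> ->] := solution_rlim S abx; have [-> ->] := solution_llim S abx.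
have [/eqP t1 /eqP t2] := theta0 abx; rewrite /theta in t1 t2.
split; (split; last by move=> [-> ->]; split; ring).
  move=> [E1 E2]; have ux : u x = 0.
    apply/eqP; have : (1 - r ^+ 2 * jump al x * jump be x) * u x = 0.
      transitivity ((u x + r * jump al x * g x) -
        r * jump al x * (g x + r * jump be x * u x)); first by ring.
      by rewrite E1 E2; ring.
    by move=> /eqP; rewrite mulf_eq0 => /orP[/eqP//|].
  by rewrite ux in E2 *; split=> //; rewrite -E2; ring.
move=> [E1 E2]; have ux : u x = 0.
  apply/eqP; have : (1 - (1 - r) ^+ 2 * jump al x * jump be x) * u x = 0.
    transitivity ((u x - (1 - r) * jump al x * g x) +
      (1 - r) * jump al x * (g x - (1 - r) * jump be x * u x)); first by ring.
    by rewrite E1 E2; ring.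
  by move=> /eqP; rewrite mulf_eq0 => /orP[/eqP//|].
by rewrite ux in E2 *; split=> //; rewrite -E2; ring.
Qed.

(** Zero data cross short intervals by contraction and cross a point by injectivity of the maps to
    the one-sided limits; compactness joins these steps. *)
Lemma vanishes_right_left u g c d : solution u g -> ooE a b c -> ooE a b d ->
  c < d -> vanishes_right u g c <-> vanishes_left u g d.
Proof.
move=> S abc abd cd; have [ru rg _ _ _] := S.
have itv z : c <= z -> z <= d -> ooE a b z by exact: ooE_itv.
have sal := BVloc_locally_small bval; have sbe := BVloc_locally_small bvbe.
pose P x y := vanishes_right u g x <-> vanishes_left u g y.
have bnd (X Y : R) : `|X - Y| < 1 -> forall Z, `|X| <= `|Y| + `|Z| + 1.
  move=> XY Z; have := ler_normD (X - Y) Y; rewrite subrK.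
  by have := normr_ge0 Z; lra.
apply: (@interval_chain R P) => //.
- move=> x y z cx xy yz zd; rewrite /P => Pxy Pyz.
  have aby : ooE a b y by apply: itv; lra.
  by have [Vr Vl] := vanishes_at S aby; rewrite Pxy Vl -Vr.
- move=> x cx xd; have abx : ooE a b x by apply: itv; lra.
  have [[e1 e10 H1] _] := sal x abx; have [[e2 e20 H2] _] := sbe x abx.
  have [e3 e30 H3] := rlim_dist ru abx ltr01.
  have [e4 e40 H4] := rlim_dist rg abx ltr01.
  exists (Num.min (Num.min e1 e2) (Num.min e3 e4)).
    by rewrite !lt_min e10 e20 e30.
  move=> y xy; rewrite -ltrBlDl !lt_min => /andP[/andP[y1 y2] /andP[y3 y4]] yd.
  have aby : ooE a b y by apply: itv; lra.
  (* One bound has to serve both functions: near x each is within 1 of its right limit. *)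
  apply: (vanishes_across (M := `|rlim u x| + `|rlim g x| + 1) r0 r1 S _ _
    abx aby xy).
  + by apply: H1 => //; lra.
  + by apply: H2 => //; lra.
  + by rewrite !addr_ge0.
  + move=> z xz zy; split; first by apply: bnd; apply: H3; lra.
    by rewrite [X in X + 1]addrC; apply: bnd; apply: H4; lra.
- move=> x cx xd; have abx : ooE a b x by apply: itv; lra.
  have [_ [e1 e10 H1]] := sal x abx; have [_ [e2 e20 H2]] := sbe x abx.
  have [e3 e30 H3] := llim_dist ru abx ltr01.
  have [e4 e40 H4] := llim_dist rg abx ltr01.
  exists (Num.min (Num.min e1 e2) (Num.min e3 e4)).
    by rewrite !lt_min e10 e20 e30.
  move=> y; rewrite ltrBlDr -ltrBlDl !lt_min.
  move=> /andP[/andP[y1 y2] /andP[y3 y4]] yx cy.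
  have aby : ooE a b y by apply: itv; lra.
  apply: (vanishes_across (M := `|llim u x| + `|llim g x| + 1) r0 r1 S _ _
    aby abx yx).
  + by apply: H1 => //; lra.
  + by apply: H2 => //; lra.
  + by rewrite !addr_ge0.
  + move=> z xz zy; split; first by apply: bnd; apply: H3; lra.
    by rewrite [X in X + 1]addrC; apply: bnd; apply: H4; lra.
Qed.

Lemma solution_unique u g x0 : solution u g -> ooE a b x0 ->
  u x0 = 0 -> g x0 = 0 -> forall x, ooE a b x -> u x = 0.
Proof.
move=> S abx0 u0 g0 x abx.
have [V0r V0l] := vanishes_at S abx0; have [Vr Vl] := vanishes_at S abx.
have [xx0|x0x|->//] := ltgtP x x0.
  have VV := vanishes_right_left S abx abx0 xx0.
  by have [] : u x = 0 /\ g x = 0 by apply/Vr/VV/V0l.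
have VV := vanishes_right_left S abx0 abx x0x.
by have [] : u x = 0 /\ g x = 0 by apply/Vl/VV/V0r.
Qed.

Definition wronskian u g v h x := u x * h x - g x * v x.

(** If W vanishes at x, the combinations of the two solutions with coefficients [(v x, - u x)] and
    [(h x, - g x)] have zero data at x. Uniqueness and independence make all four coefficients
    vanish; then [u] itself has zero data at x, which contradicts independence. *)
Lemma wronskian_neq0 u g v h x : solution u g -> solution v h ->
  lin_indep a b u v -> ooE a b x -> wronskian u g v h x != 0.
Proof.
move=> Su Sv ind abx; apply/eqP => W0.
have H c1 c2 : c1 * u x + c2 * v x = 0 -> c1 * g x + c2 * h x = 0 ->
    c1 = 0 /\ c2 = 0.
  move=> E1 E2; apply: ind => y aby.
  exact: (solution_unique (solutionD c1 c2 Su Sv) abx E1 E2).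
rewrite /wronskian in W0.
have [v0 /eqP] := H (v x) (- u x) ltac:(ring) ltac:(lra).
rewrite oppr_eq0 => /eqP u0.
have [h0 /eqP] := H (h x) (- g x) ltac:(lra) ltac:(ring).
rewrite oppr_eq0 => /eqP g0.
have [/eqP] := H 1 0 ltac:(rewrite u0; ring) ltac:(rewrite g0; ring).
by rewrite oner_eq0.
Qed.

Let wronskianE u g v h :
  wronskian u g v h = fun x => 1 * (u x * h x) + (- 1) * (g x * v x).
Proof. by apply/funext => x; rewrite mul1r mulN1r. Qed.

Lemma regulated_wronskian u g v h : solution u g -> solution v h ->
  regulated a b (wronskian u g v h).
Proof.
move=> [ru rg _ _ _] [rv rh _ _ _]; rewrite wronskianE.
by apply: regulatedD; exact: regulatedM.
Qed.

Lemma rlim_wronskian u g v h x : solution u g -> solution v h -> ooE a b x ->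
  rlim (wronskian u g v h) x = rlim u x * rlim h x - rlim g x * rlim v x.
Proof.
move=> [ru rg _ _ _] [rv rh _ _ _] abx; rewrite wronskianE.
rewrite (rlimD _ _ (regulatedM ru rh) (regulatedM rg rv))//.
by rewrite (rlimM ru rh)// (rlimM rg rv)// mul1r mulN1r.
Qed.

Lemma llim_wronskian u g v h x : solution u g -> solution v h -> ooE a b x ->
  llim (wronskian u g v h) x = llim u x * llim h x - llim g x * llim v x.
Proof.
move=> [ru rg _ _ _] [rv rh _ _ _] abx; rewrite wronskianE.
rewrite (llimD _ _ (regulatedM ru rh) (regulatedM rg rv))//.
by rewrite (llimM ru rh)// (llimM rg rv)// mul1r mulN1r.
Qed.

(** Both solutions pass from values to right limits by the same 2 by 2 matrix, and [theta al be r x]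
    is its determinant. *)
Lemma rlim_wronskian_theta u g v h x : solution u g -> solution v h ->
  ooE a b x ->
  rlim (wronskian u g v h) x = theta al be r x * wronskian u g v h x.
Proof.
move=> Su Sv abx; rewrite rlim_wronskian//.
have [-> ->] := solution_rlim Su abx.
by have [-> ->] := solution_rlim Sv abx; rewrite /theta /wronskian; ring.
Qed.

Lemma llim_wronskian_theta u g v h x : solution u g -> solution v h ->
  ooE a b x ->
  llim (wronskian u g v h) x = theta al be (1 - r) x * wronskian u g v h x.
Proof.
move=> Su Sv abx; rewrite llim_wronskian//.
have [-> ->] := solution_llim Su abx.
by have [-> ->] := solution_llim Sv abx; rewrite /theta /wronskian; ring.
Qed.

Lemma wronskian_jump u g v h x : solution u g -> solution v h -> ooE a b x ->
  llim u x * rlim v x - rlim u x * llim v x =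
  jump al x * wronskian u g v h x.
Proof.
move=> Su Sv abx; have [-> _] := solution_llim Su abx.
have [-> _] := solution_llim Sv abx; have [-> _] := solution_rlim Su abx.
by have [-> _] := solution_rlim Sv abx; rewrite /wronskian; ring.
Qed.

End solutions.

(** * One-sided signs *)

Section one_sided_signs.
Context (R : realType) (a b : \bar R).
Implicit Types (f g u v h : R -> R) (x y z s t e : R).

(** Both limits at y are recorded: [changes_sign_at] reads left limits on the left and right limits
    on the right, while propagation along an interval reads the other ones. *)
Definition right_of f x (Q : R -> Prop) := exists2 e, 0 < e &
  forall y, ooE a b y -> x < y -> y < x + e -> Q (llim f y) /\ Q (rlim f y).

Definition left_of f x (Q : R -> Prop) := exists2 e, 0 < e &
  forall y, ooE a b y -> x - e < y -> y < x -> Q (llim f y) /\ Q (rlim f y).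

Lemma rlim_gt0 f x : regulated a b f -> ooE a b x -> 0 < rlim f x ->
  right_of f x (fun z => 0 < z).
Proof.
move=> rf abx fx0.
have fx20 : 0 < rlim f x / 2 by lra.
have [e e0 He] := rlim_dist rf abx fx20.
have H z : x < z -> z < x + e -> rlim f x / 2 <= f z.
  by move=> xz ze; have := He z xz ze; rewrite ltr_norml => /andP[]; lra.
exists e => // y aby xy ye; split; apply: (lt_le_trans fx20).
  by apply: (llim_ge rf aby xy) => z xz zy; apply: H => //; exact: lt_trans ye.
by apply: (rlim_ge rf aby ye) => z yz ze; apply: H => //; exact: lt_trans yz.
Qed.

Lemma llim_gt0 f x : regulated a b f -> ooE a b x -> 0 < llim f x ->
  left_of f x (fun z => 0 < z).
Proof.
move=> rf abx fx0.
have fx20 : 0 < llim f x / 2 by lra.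
have [e e0 He] := llim_dist rf abx fx20.
have H z : x - e < z -> z < x -> llim f x / 2 <= f z.
  by move=> xz ze; have := He z xz ze; rewrite ltr_norml => /andP[]; lra.
exists e => // y aby xy ye; split; apply: (lt_le_trans fx20).
  by apply: (llim_ge rf aby xy) => z xz zy; apply: H => //; exact: lt_trans ye.
by apply: (rlim_ge rf aby ye) => z yz ze; apply: H => //; exact: lt_trans yz.
Qed.

Lemma regulatedN f : regulated a b f -> regulated a b (fun y => - f y).
Proof.
by move=> rf x abx; have [? ?] := rf x abx; split; exact: is_cvgN.
Qed.

Lemma rlimN f x : regulated a b f -> ooE a b x ->
  rlim (fun y => - f y) x = - rlim f x.
Proof.
by move=> rf abx; apply: cvg_lim => //; apply: cvgN; have [] := rf x abx.
Qed.

Lemma llimN f x : regulated a b f -> ooE a b x ->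
  llim (fun y => - f y) x = - llim f x.
Proof.
by move=> rf abx; apply: cvg_lim => //; apply: cvgN; have [] := rf x abx.
Qed.

Lemma rlim_lt0 f x : regulated a b f -> ooE a b x -> rlim f x < 0 ->
  right_of f x (fun z => z < 0).
Proof.
move=> rf abx fx0; have [|e e0 He] := rlim_gt0 (regulatedN rf) abx.
  by rewrite rlimN// oppr_gt0.
exists e => // y aby xy ye; have := He y aby xy ye.
by rewrite llimN// rlimN// !oppr_gt0.
Qed.

Lemma llim_lt0 f x : regulated a b f -> ooE a b x -> llim f x < 0 ->
  left_of f x (fun z => z < 0).
Proof.
move=> rf abx fx0; have [|e e0 He] := llim_gt0 (regulatedN rf) abx.
  by rewrite llimN// oppr_gt0.
exists e => // y aby xy ye; have := He y aby xy ye.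
by rewrite llimN// rlimN// !oppr_gt0.
Qed.

Lemma rlim_ge0_of_gt0 f s t : regulated a b f -> ooE a b s -> ooE a b t ->
  s < t -> (forall x, s < x -> x < t -> 0 < llim f x) -> 0 <= rlim f s.
Proof.
move=> rf abs abt st f0; rewrite leNgt; apply/negP => /(rlim_lt0 rf abs).
move=> [e e0 He]; have [y [sy ye yt]] := exists_between_right st e0.
have [] := He y (ooE_itv abs abt (ltW sy) (ltW yt)) sy ye.
by have := f0 y sy yt => /ltW; rewrite leNgt => /negbTE ->.
Qed.

Lemma llim_ge0_of_gt0 f s t : regulated a b f -> ooE a b s -> ooE a b t ->
  s < t -> (forall x, s < x -> x < t -> 0 < rlim f x) -> 0 <= llim f t.
Proof.
move=> rf abs abt st f0; rewrite leNgt; apply/negP => /(llim_lt0 rf abt).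
move=> [e e0 He]; have [y [ye yt sy]] := exists_between_left st e0.
have [_] := He y (ooE_itv abs abt (ltW sy) (ltW yt)) ye yt.
by have := f0 y sy yt => /ltW; rewrite leNgt => /negbTE ->.
Qed.

(** An intermediate value theorem for regulated functions. The relation [0 < rlim f x * llim f y]
    passes through a point q because [llim f q * rlim f q] is positive. *)
Lemma constant_sign f s t : regulated a b f -> ooE a b s -> ooE a b t ->
  s < t -> (forall x, s < x -> x < t -> 0 < llim f x * rlim f x) ->
  (forall x, s < x -> x < t -> 0 < llim f x /\ 0 < rlim f x) \/
  (forall x, s < x -> x < t -> llim f x < 0 /\ rlim f x < 0).
Proof.
move=> rf abs abt st f0.
have itv z : s < z -> z < t -> ooE a b z.
  by move=> /ltW sz /ltW zt; exact: ooE_itv abs abt sz zt.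
have H x y : s < x -> x < y -> y < t -> 0 < rlim f x * llim f y.
  move=> sx xy yt; apply: (@interval_chain R
    (fun x y => 0 < rlim f x * llim f y) x y xy) => [p q q' xp pq qq' q'y Ppq Pqq'|p xp py|p xp py].
  - have fq : 0 < llim f q * rlim f q.
      by apply: f0; [exact: lt_le_trans sx (le_trans xp (ltW pq))|
        exact: lt_trans qq' (le_lt_trans q'y yt)].
    have : 0 < (rlim f p * llim f q') * (llim f q * rlim f q).
      have -> : (rlim f p * llim f q') * (llim f q * rlim f q) =
        (rlim f p * llim f q) * (rlim f q * llim f q') by ring.
      exact: mulr_gt0.
    by rewrite pmulr_lgt0.
  - have sp : s < p by exact: lt_le_trans xp.
    have pt : p < t by exact: lt_trans yt.
    have := f0 p sp pt; have [fp|fp|->] := ltgtP (rlim f p) 0; last first.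
    + by rewrite mulr0 ltxx.
    + move=> _; have [e e0 He] := rlim_gt0 rf (itv p sp pt) fp.
      exists e => // q pq qe qy; apply: mulr_gt0 => //.
      by have [] := He q (itv q (lt_trans sp pq) (le_lt_trans qy yt)) pq qe.
    + move=> _; have [e e0 He] := rlim_lt0 rf (itv p sp pt) fp.
      exists e => // q pq qe qy; rewrite nmulr_rgt0//.
      by have [] := He q (itv q (lt_trans sp pq) (le_lt_trans qy yt)) pq qe.
  - have sp : s < p by exact: lt_trans xp.
    have pt : p < t by exact: le_lt_trans yt.
    have := f0 p sp pt; have [fp|fp|->] := ltgtP (llim f p) 0; last first.
    + by rewrite mul0r ltxx.
    + move=> _; have [e e0 He] := llim_gt0 rf (itv p sp pt) fp.
      exists e => // q pq qe qy; apply: mulr_gt0 => //.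
      by have [] := He q (itv q (lt_le_trans sx qy) (lt_trans qe pt)) pq qe.
    + move=> _; have [e e0 He] := llim_lt0 rf (itv p sp pt) fp.
      exists e => // q pq qe qy; rewrite nmulr_lgt0//.
      by have [] := He q (itv q (lt_le_trans sx qy) (lt_trans qe pt)) pq qe.
pose m := (s + t) / 2.
have [sm mt] : s < m /\ m < t by split; rewrite /m; lra.
have fm := f0 m sm mt.
have [fm0|fm0|fm0] := ltgtP (rlim f m) 0; last by rewrite fm0 mulr0 ltxx in fm.
- have fm1 : llim f m < 0 by rewrite nmulr_lgt0 in fm.
  right=> x sx xt; have := f0 x sx xt.
  have [xm|mx|->//] := ltgtP x m.
    have := H x m sx xm mt; rewrite nmulr_lgt0// => fx.
    by rewrite nmulr_lgt0.
  have := H m x sm mx xt; rewrite nmulr_rgt0// => fx.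
  by rewrite nmulr_rgt0.
- have fm1 : 0 < llim f m by rewrite pmulr_lgt0 in fm.
  left=> x sx xt; have := f0 x sx xt.
  have [xm|mx|->//] := ltgtP x m.
    have := H x m sx xm mt; rewrite pmulr_lgt0// => fx.
    by rewrite pmulr_lgt0.
  have := H m x sm mx xt; rewrite pmulr_rgt0// => fx.
  by rewrite pmulr_rgt0.
Qed.

Lemma changes_sign_at_sides f x : ooE a b x ->
  (left_of f x (fun z => z < 0) /\ right_of f x (fun z => 0 < z)) \/
  (left_of f x (fun z => 0 < z) /\ right_of f x (fun z => z < 0)) ->
  changes_sign_at a b f x.
Proof.
move=> abx H; split=> //.
have [c abc cx] := ooE_lt abx; have [d abd xd] := ooE_gt abx.
have sub e : 0 < e -> e <= x - c -> e <= d - x -> forall y, x - e < y ->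
    y < x + e -> ooE a b y.
  move=> e0 ec ed y yx xy; apply: ooE_itv abc abd _ _; lra.
have itv z p q : (z \in `]p, q[) = (p < z) && (z < q) by rewrite in_itv.
have [[[e1 e10 H1] [e2 e20 H2]]|[[e1 e10 H1] [e2 e20 H2]]] := H.
- pose e := Num.min (Num.min e1 e2) (Num.min (x - c) (d - x)).
  have e0 : 0 < e by rewrite !lt_min e10 e20 !subr_gt0 cx xd.
  have [[l1 l2] [l3 l4]] : (e <= e1 /\ e <= e2) /\ (e <= x - c /\ e <= d - x).
    by rewrite /e !ge_min !lexx ?orbT.
  have {}sub := sub e e0 l3 l4.
  exists e; split=> //.
    by move=> y; rewrite /= itv => /andP[]; exact: sub.
  left; split=> y; rewrite itv => /andP[y1 y2].
    by have [] := H1 y (sub y y1 ltac:(lra)) ltac:(lra) y2.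
  by have [] := H2 y (sub y ltac:(lra) y2) y1 ltac:(lra).
- pose e := Num.min (Num.min e1 e2) (Num.min (x - c) (d - x)).
  have e0 : 0 < e by rewrite !lt_min e10 e20 !subr_gt0 cx xd.
  have [[l1 l2] [l3 l4]] : (e <= e1 /\ e <= e2) /\ (e <= x - c /\ e <= d - x).
    by rewrite /e !ge_min !lexx ?orbT.
  have {}sub := sub e e0 l3 l4.
  exists e; split=> //.
    by move=> y; rewrite /= itv => /andP[]; exact: sub.
  right; split=> y; rewrite itv => /andP[y1 y2].
    by have [] := H1 y (sub y y1 ltac:(lra)) ltac:(lra) y2.
  by have [] := H2 y (sub y ltac:(lra) y2) y1 ltac:(lra).
Qed.

End one_sided_signs.

(** * Oscillation between two zeros *)

(** The five conclusions are bundled so that [u] or [v] can be replaced by its negative in all of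
    them at once. *)
Definition sign_changes (R : realType) (a b : \bar R) (r : R)
    (al be u v : R -> R) (s t : R) :=
  (llim u s * rlim u s < 0 -> llim u t = 0 ->
   0 < theta al be r s ->
   changes_sign_in a b v `[s, t[%classic) /\
  (rlim u s = 0 -> llim u t * rlim u t < 0 ->
   0 < theta al be (1 - r) t ->
   changes_sign_in a b v `]s, t]%classic) /\
  (llim u s * rlim u s < 0 -> rlim u t = 0 ->
   0 < theta al be r s * theta al be (1 - r) t ->
   changes_sign_in a b v `[s, t]%classic) /\
  (llim u s = 0 -> llim u t * rlim u t < 0 ->
   0 < theta al be r s * theta al be (1 - r) t ->
   changes_sign_in a b v `[s, t]%classic) /\
  (llim u s * rlim u s < 0 -> llim u t * rlim u t < 0 ->
   0 < theta al be r s * theta al be (1 - r) t ->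
   changes_sign_in a b v `[s, t]%classic).

Section oscillation.
Context (R : realType) (a b : \bar R) (r : R) (al be : R -> R).
Hypothesis sal : strictly_increasing a b al.
Context (u g v h : R -> R).
Hypotheses (Su : solution a b r al be u g) (Sv : solution a b r al be v h).
Implicit Types (x y z s t e : R).

Let W := wronskian u g v h.

(** When v^+ = 0, W^+ reduces to u^+ h^+, whose positivity also excludes u^+ = 0. A weak inequality
    for u^+ therefore suffices, and the endpoint s is covered. *)
Lemma right_of_gt0 x : ooE a b x -> 0 <= rlim u x -> 0 < rlim W x ->
  0 <= rlim v x -> right_of a b v x (fun z => 0 < z).
Proof.
have [rv rh _ _ [dv _]] := Sv; move=> abx u0 W0; rewrite le_eqVlt.
move=> /orP[/eqP v0|]; last exact: rlim_gt0.
apply: (rlim0_gt0_right sal rv rh dv abx); first by rewrite -v0.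
move: W0; rewrite (rlim_wronskian Su Sv abx) -v0 mulr0 subr0.
move: u0; rewrite le_eqVlt => /orP[/eqP<-|u0];
  by rewrite ?mul0r ?ltxx ?pmulr_rgt0.
Qed.

Lemma left_of_lt0 x : ooE a b x -> 0 <= llim u x -> 0 < llim W x ->
  llim v x <= 0 -> left_of a b v x (fun z => z < 0).
Proof.
have [rv rh _ _ [dv _]] := Sv; move=> abx u0 W0; rewrite le_eqVlt.
move=> /orP[/eqP v0|]; last exact: llim_lt0.
apply: (llim0_lt0_left sal rv rh dv abx v0).
move: W0; rewrite (llim_wronskian Su Sv abx) v0 mulr0 subr0.
move: u0; rewrite le_eqVlt => /orP[/eqP<-|u0];
  by rewrite ?mul0r ?ltxx ?pmulr_rgt0.
Qed.

(** A vanishing limit of [v] counts as positive to the right of a point and as negative to the left,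
    whence one weak and one strict inequality. With this convention, disagreement of the two sides
    at an interior point is a change of sign. *)
Lemma changes_sign_or_propagates s t : ooE a b s -> ooE a b t -> s < t ->
  (forall x, s <= x -> x < t -> 0 <= rlim u x /\ 0 < rlim W x) ->
  (forall x, s < x -> x <= t -> 0 <= llim u x /\ 0 < llim W x) ->
  (exists x, [/\ s < x, x < t & changes_sign_at a b v x]) \/
  (0 <= rlim v s <-> 0 < llim v t).
Proof.
move=> abs abt st HR HL; have [rv _ _ _ _] := Sv.
have itv z : s <= z -> z <= t -> ooE a b z by exact: ooE_itv abs abt.
have [C|nC] := pselect (exists x, [/\ s < x, x < t & changes_sign_at a b v x]).
  by left.
right.
pose P x y := 0 <= rlim v x <-> 0 < llim v y.
apply: (@interval_chain R P) => //.
- move=> x y z sx xy yz zt; rewrite /P => -> <-.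
  have [sy yt] : s < y /\ y < t.
    by split; [exact: le_lt_trans xy|exact: lt_le_trans zt].
  have aby := itv y (ltW sy) (ltW yt).
  have [uR wR] := HR y (ltW sy) yt; have [uL wL] := HL y sy (ltW yt).
  have N : ~ changes_sign_at a b v y by move=> C; apply: nC; exists y.
  split=> vy.
    rewrite leNgt; apply/negP => vy'; apply/N/changes_sign_at_sides => //.
    by right; split; [exact: llim_gt0|exact: rlim_lt0].
  rewrite ltNge; apply/negP => vy'; apply/N/changes_sign_at_sides => //.
  by left; split; [exact: left_of_lt0|exact: right_of_gt0].
- move=> x sx xt; have abx := itv x sx (ltW xt).
  have [uR wR] := HR x sx xt; rewrite /P.
  have [v0|v0] := leP 0 (rlim v x).
    have [e e0 He] := right_of_gt0 abx uR wR v0; exists e => // y xy ye yt.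
    have aby := itv y (le_trans sx (ltW xy)) yt.
    by have [-> _] := He y aby xy ye.
  have [e e0 He] := rlim_lt0 rv abx v0; exists e => // y xy ye yt.
  have aby := itv y (le_trans sx (ltW xy)) yt.
  by have [/ltW + _] := He y aby xy ye; rewrite leNgt => /negbTE ->.
- move=> x sx xt; have abx := itv x (ltW sx) xt.
  have [uL wL] := HL x sx xt; rewrite /P.
  have [v0|v0] := ltP 0 (llim v x).
    have [e e0 He] := llim_gt0 rv abx v0; exists e => // y xy ye yt.
    have aby := itv y yt (le_trans (ltW ye) xt).
    by have [_ /ltW ->] := He y aby xy ye.
  have [e e0 He] := left_of_lt0 abx uL wL v0; exists e => // y xy ye yt.
  have aby := itv y yt (le_trans (ltW ye) xt).
  by have [_] := He y aby xy ye; rewrite ltNge => /negbTE ->.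
Qed.

Hypothesis W_neq0 : forall x, ooE a b x -> W x != 0.

Lemma jump_gt0 x : ooE a b x -> llim u x != rlim u x -> 0 < jump al x.
Proof.
move=> abx lr; rewrite lt_neqAle (strictly_increasing_jump sal abx) andbT.
rewrite eq_sym.
apply: contra lr => /eqP j0; have [_ _ _ _ [[ju _] _]] := Su.
by have := ju x abx; rewrite j0 mulr0 /jump => /eqP; rewrite subr_eq0 eq_sym.
Qed.

(** If v^- and v^+ were both nonnegative, u^- v^+ - u^+ v^- would be nonpositive, yet it is W times
    the jump of [al], which is positive because [u] jumps. The case W < 0 is the same with signs
    reversed. *)
Lemma start_signs x : ooE a b x -> llim u x <= 0 -> 0 <= rlim u x ->
  llim u x != rlim u x ->
  (0 < W x -> llim v x < 0 \/ rlim v x < 0) /\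
  (W x < 0 -> 0 < llim v x \/ 0 < rlim v x).
Proof.
move=> abx ul ur lr; have j0 := jump_gt0 abx lr.
have E := wronskian_jump Su Sv abx.
split=> W0.
  have [vl|vl] := ltP (llim v x) 0; [by left|right].
  rewrite ltNge; apply/negP => vr.
  have : 0 < jump al x * W x by exact: mulr_gt0.
  rewrite -E ltNge => /negP; apply; rewrite subr_le0.
  exact: le_trans (mulr_le0_ge0 ul vr) (mulr_ge0 ur vl).
have [vl|vl] := ltP 0 (llim v x); [by left|right].
rewrite ltNge; apply/negP => vr.
have : jump al x * W x < 0 by rewrite pmulr_rlt0.
rewrite -E ltNge => /negP; apply; rewrite subr_ge0.
exact: le_trans (mulr_ge0_le0 ur vl) (mulr_le0 ul vr).
Qed.

Lemma end_signs x : ooE a b x -> 0 <= llim u x -> rlim u x <= 0 ->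
  llim u x != rlim u x ->
  (0 < W x -> 0 < llim v x \/ 0 < rlim v x) /\
  (W x < 0 -> llim v x < 0 \/ rlim v x < 0).
Proof.
move=> abx ul ur lr; have j0 := jump_gt0 abx lr.
have E := wronskian_jump Su Sv abx.
split=> W0.
  have [vl|vl] := ltP 0 (llim v x); [by left|right].
  rewrite ltNge; apply/negP => vr.
  have : 0 < jump al x * W x by exact: mulr_gt0.
  rewrite -E ltNge => /negP; apply; rewrite subr_le0.
  exact: le_trans (mulr_ge0_le0 ul vr) (mulr_le0 ur vl).
have [vl|vl] := ltP (llim v x) 0; [by left|right].
rewrite ltNge; apply/negP => vr.
have : jump al x * W x < 0 by rewrite pmulr_rlt0.
rewrite -E ltNge => /negP; apply; rewrite subr_ge0.
exact: le_trans (mulr_le0_ge0 ur vl) (mulr_ge0 ul vr).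
Qed.

(** Here u = 0 at x, so W <> 0 gives g <> 0; as [u] has jump [g x * jump al x = 0], [al] has no jump
    at x. This settles endpoints where the jump of [u] carries no information. *)
Lemma theta_at_double_zero z x : ooE a b x -> llim u x = 0 -> rlim u x = 0 ->
  theta al be z x = 1.
Proof.
move=> abx ul ur; have [_ _ bu _ [[ju _] _]] := Su.
have ux : u x = 0 by rewrite bu// ul ur !mulr0 addr0.
have gx : g x != 0.
  apply: contra (W_neq0 abx) => /eqP gx.
  by rewrite /W /wronskian ux gx !mul0r subrr.
have := ju x abx; rewrite {1}/jump ul ur subrr => /esym/eqP.
rewrite mulf_eq0 (negbTE gx)/= => /eqP j0.
by rewrite /theta j0 mulr0 mul0r subr0.
Qed.

Context (s t : R) (abs : ooE a b s) (abt : ooE a b t) (st : s < t).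
Hypothesis u_gt0 : forall x, s < x -> x < t -> 0 < llim u x /\ 0 < rlim u x.
Hypothesis W_gt0 : forall x, s < x -> x < t -> 0 < llim W x /\ 0 < rlim W x.

Hypothesis theta0 : forall x, ooE a b x ->
  theta al be (1 - r) x != 0 /\ theta al be r x != 0.

Let itv z : s <= z -> z <= t -> ooE a b z.
Proof. exact: ooE_itv abs abt. Qed.

Let u_start : 0 <= rlim u s.
Proof.
have [ru _ _ _ _] := Su; apply: (rlim_ge0_of_gt0 ru abs abt st) => x sx xt.
by have [] := u_gt0 sx xt.
Qed.

Let u_end : 0 <= llim u t.
Proof.
have [ru _ _ _ _] := Su; apply: (llim_ge0_of_gt0 ru abs abt st) => x sx xt.
by have [] := u_gt0 sx xt.
Qed.

(** The limit alone gives only a weak inequality; strictness comes from W^+ = theta_r W, where both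
    factors are nonzero. *)
Let W_start : 0 < rlim W s.
Proof.
rewrite lt_neqAle; apply/andP; split.
  rewrite eq_sym (rlim_wronskian_theta Su Sv abs) mulf_neq0//.
    by have [] := theta0 abs.
  exact: W_neq0.
apply: (rlim_ge0_of_gt0 (regulated_wronskian Su Sv) abs abt st) => x sx xt.
by have [] := W_gt0 sx xt.
Qed.

Let W_end : 0 < llim W t.
Proof.
rewrite lt_neqAle; apply/andP; split.
  rewrite eq_sym (llim_wronskian_theta Su Sv abt) mulf_neq0//.
    by have [] := theta0 abt.
  exact: W_neq0.
apply: (llim_ge0_of_gt0 (regulated_wronskian Su Sv) abs abt st) => x sx xt.
by have [] := W_gt0 sx xt.
Qed.

Let propagation : (exists x, [/\ s < x, x < t & changes_sign_at a b v x]) \/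
  (0 <= rlim v s <-> 0 < llim v t).
Proof.
apply: changes_sign_or_propagates => // x.
  rewrite le_eqVlt => /orP[/eqP<-//|sx] xt.
  by have [_ /ltW ->] := u_gt0 sx xt; have [] := W_gt0 sx xt.
move=> sx; rewrite le_eqVlt => /orP[/eqP->//|xt].
by have [/ltW -> _] := u_gt0 sx xt; have [] := W_gt0 sx xt.
Qed.

Let change_at_start : llim v s < 0 -> 0 <= rlim v s -> changes_sign_at a b v s.
Proof.
have [rv _ _ _ _] := Sv; move=> vl vr; apply: changes_sign_at_sides => //.
by left; split; [exact: llim_lt0|exact: right_of_gt0].
Qed.

Let change_at_start' : 0 < llim v s -> rlim v s < 0 -> changes_sign_at a b v s.
Proof.
have [rv _ _ _ _] := Sv; move=> vl vr; apply: changes_sign_at_sides => //.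
by right; split; [exact: llim_gt0|exact: rlim_lt0].
Qed.

Let change_at_end : llim v t <= 0 -> 0 < rlim v t -> changes_sign_at a b v t.
Proof.
have [rv _ _ _ _] := Sv; move=> vl vr; apply: changes_sign_at_sides => //.
by left; split; [exact: left_of_lt0|exact: rlim_gt0].
Qed.

Let change_at_end' : 0 < llim v t -> rlim v t < 0 -> changes_sign_at a b v t.
Proof.
have [rv _ _ _ _] := Sv; move=> vl vr; apply: changes_sign_at_sides => //.
by right; split; [exact: llim_gt0|exact: rlim_lt0].
Qed.

(** As [u] is positive before t and has left limit 0 there, g^-(t) <= 0. Then W^-(t) = - g^-(t)
    v^-(t) > 0 forces v^-(t) > 0. *)
Let v_end_zero : llim u t = 0 -> 0 < llim v t.
Proof.
move=> ut; have [ru rg _ _ [du _]] := Su.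
have gt : llim g t <= 0.
  rewrite leNgt; apply/negP => gt0.
  have [e e0 He] := llim0_lt0_left sal ru rg du abt ut gt0.
  have [y [ye yt sy]] := exists_between_left st e0.
  have [+ _] := He y (itv (ltW sy) (ltW yt)) ye yt.
  by have [/ltW + _] := u_gt0 sy yt; rewrite leNgt => /negbTE ->.
have := W_end; rewrite (llim_wronskian Su Sv abt) ut mul0r sub0r.
rewrite oppr_gt0 ltNge => W0.
by rewrite ltNge; apply: contra W0 => vt; exact: mulr_le0.
Qed.

Let v_start_zero : rlim u s = 0 -> rlim v s < 0.
Proof.
move=> us; have [ru rg _ _ [du _]] := Su.
have gs : 0 <= rlim g s.
  rewrite leNgt; apply/negP => gs0.
  (* If g^+(s) were negative, [- u] would be positive just to the right of s. *)
  have Sn := solutionD (- 1) 0 Su Su.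
  have [rnu rng _ _ [dnu _]] := Sn.
  have [||e e0 He] := rlim0_gt0_right sal rnu rng dnu abs.
    by rewrite (rlimD _ _ ru ru)// us !mulr0 addr0.
    by rewrite (rlimD _ _ rg rg)// mul0r addr0 mulN1r oppr_gt0.
  have [y [sy ye yt]] := exists_between_right st e0.
  have aby := itv (ltW sy) (ltW yt).
  have [+ _] := He y aby sy ye.
  rewrite (llimD _ _ ru ru)// mul0r addr0 mulN1r oppr_gt0.
  by have [/ltW + _] := u_gt0 sy yt; rewrite leNgt => /negbTE ->.
have := W_start; rewrite (rlim_wronskian Su Sv abs) us mul0r sub0r.
rewrite oppr_gt0 ltNge => W0.
by rewrite ltNge; apply: contra W0 => vt; exact: mulr_ge0.
Qed.

(** Assume no change inside (s, t), a negative limit of [v] at s and a positive one at t. If v^+(s)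
    >= 0, the negative limit is v^-(s) and the change is at s; otherwise propagation gives v^-(t) <=
    0, the positive limit is v^+(t) and the change is at t. The other alternative is analogous. *)
Let change_opposite :
  ((llim v s < 0 \/ rlim v s < 0) /\ (0 < llim v t \/ 0 < rlim v t)) \/
  ((0 < llim v s \/ 0 < rlim v s) /\ (llim v t < 0 \/ rlim v t < 0)) ->
  changes_sign_in a b v `[s, t]%classic.
Proof.
have Is : `[s, t]%classic s by rewrite /= in_itv/= lexx ltW.
have It : `[s, t]%classic t by rewrite /= in_itv/= lexx ltW.
have [[x [sx xt C]] _|E] := propagation.
  by exists x => //; rewrite /= in_itv/= !ltW.
move=> [[S T]|[S T]]; have [vr|vr] := leP 0 (rlim v s).
- by exists s => //; apply: change_at_start => //;
    case: S => //; rewrite ltNge vr.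
- have vt : llim v t <= 0.
    by rewrite leNgt; apply/negP => /E; rewrite leNgt vr.
  by exists t => //; apply: change_at_end => //;
    case: T => //; rewrite ltNge vt.
- have vt := E.1 vr.
  by exists t => //; apply: change_at_end' => //;
    case: T => // /ltW; rewrite leNgt vt.
- by exists s => //; apply: change_at_start' => //;
    case: S => // /ltW; rewrite leNgt vr.
Qed.

Let W_start_sign : (0 < W s) = (0 < theta al be r s).
Proof.
have := W_start; rewrite (rlim_wronskian_theta Su Sv abs) => W0.
apply/idP/idP => H; first by rewrite pmulr_lgt0 in W0.
by rewrite pmulr_rgt0 in W0.
Qed.

Let W_end_sign : (0 < W t) = (0 < theta al be (1 - r) t).
Proof.
have := W_end; rewrite (llim_wronskian_theta Su Sv abt) => W0.
apply/idP/idP => H; first by rewrite pmulr_lgt0 in W0.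
by rewrite pmulr_rgt0 in W0.
Qed.

Let start_of_product : llim u s * rlim u s < 0 ->
  llim u s < 0 /\ 0 < rlim u s.
Proof.
move: u_start; rewrite le_eqVlt => /orP[/eqP<-|ur]; first by rewrite mulr0 ltxx.
by rewrite pmulr_llt0.
Qed.

Let end_of_product : llim u t * rlim u t < 0 ->
  0 < llim u t /\ rlim u t < 0.
Proof.
move: u_end; rewrite le_eqVlt => /orP[/eqP<-|ur]; first by rewrite mul0r ltxx.
by rewrite pmulr_rlt0.
Qed.

(** This covers the three closed-interval conclusions. The theta condition gives W the same sign at
    s and t, so [start_signs] and [end_signs] yield limits of [v] of opposite signs. Where [u] does
    not jump at an end, it has a double zero there, so W is positive and [v_start_zero] or
    [v_end_zero] takes over. *)
Let change_endpoints :
  llim u s <= 0 -> rlim u t <= 0 ->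
  0 < theta al be r s * theta al be (1 - r) t ->
  changes_sign_in a b v `[s, t]%classic.
Proof.
move=> us ut th0.
have start : (0 < W s -> llim v s < 0 \/ rlim v s < 0) /\
    (W s < 0 -> 0 < llim v s \/ 0 < rlim v s).
  have [e|ne] := eqVneq (llim u s) (rlim u s); last exact: start_signs.
  have us0 : rlim u s = 0 by apply/eqP; rewrite eq_le u_start andbT -e.
  split=> [_|W0]; first by right; exact: v_start_zero.
  have := W_start_sign; rewrite theta_at_double_zero// ?e// ltr01.
  by rewrite ltNge (ltW W0).
have end_ : (0 < W t -> 0 < llim v t \/ 0 < rlim v t) /\
    (W t < 0 -> llim v t < 0 \/ rlim v t < 0).
  have [e|ne] := eqVneq (llim u t) (rlim u t); last exact: end_signs.
  have ut0 : llim u t = 0 by apply/eqP; rewrite eq_le u_end andbT e.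
  split=> [_|W0]; first by left; exact: v_end_zero.
  have := W_end_sign; rewrite theta_at_double_zero// -?e// ltr01.
  by rewrite ltNge (ltW W0).
have [W1 W2] := (W_neq0 abs, W_neq0 abt).
apply: change_opposite.
have [t1|t1] := ltP 0 (theta al be r s).
  rewrite pmulr_rgt0// in th0; left.
  by split; [apply: start.1; rewrite W_start_sign|
    apply: end_.1; rewrite W_end_sign].
right; split.
  by apply: start.2; rewrite lt_neqAle W1/= leNgt W_start_sign -leNgt.
apply: end_.2; rewrite lt_neqAle W2/= leNgt W_end_sign -leNgt.
rewrite leNgt; apply/negP => t2.
by move: th0; rewrite pmulr_lgt0// ltNge t1.
Qed.

Lemma sign_changes_of_gt0 : sign_changes a b r al be u v s t.
Proof.
split; [|split; [|split; [|split]]].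
- move=> /start_of_product[ul ur] ut; rewrite -W_start_sign => W0.
  have [[x [sx xt C]]|E] := propagation.
    by exists x => //; rewrite /= in_itv/= (ltW sx) xt.
  exists s; first by rewrite /= in_itv/= lexx st.
  (* Since u^-(t) = 0 makes v^-(t) positive, propagation back to s leaves a change at s, never at t;
     hence the half-open interval. *)
  have vs : 0 <= rlim v s by apply/E/v_end_zero.
  apply: change_at_start => //.
  have [H _] := start_signs abs (ltW ul) (ltW ur)
    (negbT (lt_eqF (lt_trans ul ur))).
  by case: (H W0) => //; rewrite ltNge vs.
- move=> us /end_of_product[ul ur]; rewrite -W_end_sign => W0.
  have [[x [sx xt C]]|E] := propagation.
    by exists x => //; rewrite /= in_itv/= (ltW xt) sx.
  exists t; first by rewrite /= in_itv/= lexx st.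
  have vt : llim v t <= 0.
    by rewrite leNgt; apply/negP => /E; rewrite leNgt v_start_zero.
  apply: change_at_end => //.
  have [H _] := end_signs abt (ltW ul) (ltW ur)
    (negbT (gt_eqF (lt_trans ur ul))).
  by case: (H W0) => //; rewrite ltNge vt.
- move=> /start_of_product[ul ur] ut th0.
  by apply: change_endpoints; rewrite ?ut ?(ltW ul)//.
- move=> us /end_of_product[ul ur] th0.
  by apply: change_endpoints; rewrite ?us ?(ltW ur)//.
- move=> /start_of_product[ul _] /end_of_product[_ ur] th0.
  by apply: change_endpoints; rewrite ?(ltW ul) ?(ltW ur)//.
Qed.

End oscillation.

(** * From measures to one-sided limits *)

Section measures.
Context (R : realType) (a b : \bar R).
Implicit Types (mu da df : lmeasure a b) (f g h al : R -> R) (x y z k e : R).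
Implicit Types (E : set (measurableTypeR R)).

Lemma bounded_borel_fin mu E : bounded_borel a b E ->
  lpos mu E \is a fin_num /\ lneg mu E \is a fin_num.
Proof.
move=> [mE [c [d [abc abd Ecd]]]].
have mcd : measurable (`[c, d]%classic : set (measurableTypeR R)).
  exact: measurable_itv.
split; rewrite ge0_fin_numE//.
  by apply: le_lt_trans (lpos_locally_finite mu abc abd); apply: le_measure;
    rewrite ?inE.
by apply: le_lt_trans (lneg_locally_finite mu abc abd); apply: le_measure;
  rewrite ?inE.
Qed.

Lemma lvarE mu E : lvar mu E = (lpos mu E + lneg mu E)%E.
Proof. exact: measure_addE. Qed.

Lemma fine_lval mu E : bounded_borel a b E ->
  fine (lval mu E) = fine (lpos mu E) - fine (lneg mu E).
Proof. by move=> /(bounded_borel_fin mu)[? ?]; rewrite /lval fineB. Qed.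

Lemma fine_lvar mu E : bounded_borel a b E ->
  fine (lvar mu E) = fine (lpos mu E) + fine (lneg mu E).
Proof.
by move=> /(bounded_borel_fin mu)[? ?]; rewrite lvarE fineD.
Qed.

Lemma lintegrable_pos_neg mu h E : lintegrable mu h -> bounded_borel a b E ->
  (lpos mu).-integrable E (EFin \o h) /\ (lneg mu).-integrable E (EFin \o h).
Proof.
move=> ih [mE [c [d [abc abd Ecd]]]].
have mcd : measurable (`[c, d]%classic : set (measurableTypeR R)).
  exact: measurable_itv.
have /integrableP[mh] := ih c d abc abd.
rewrite /lvar ge0_integral_measure_add//; last first.
  exact: measurable_int (integrable_abse (ih c d abc abd)).
move=> fin.
split; apply: (integrableS mcd mE Ecd); apply/integrableP; split=> //.
  by apply: le_lt_trans fin; rewrite leeDl// integral_ge0.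
by apply: le_lt_trans fin; rewrite leeDr// integral_ge0.
Qed.

Lemma Rintegral_near (m : {measure set (measurableTypeR R) -> \bar R}) E h k e :
  measurable E -> m E \is a fin_num -> m.-integrable E (EFin \o h) ->
  (forall x, E x -> `|h x - k| <= e) ->
  `|fine (\int[m]_(x in E) (h x)%:E)%E - k * fine (m E)| <= e * fine (m E).
Proof.
move=> mE fE ih hk; rewrite -/(Rintegral m E h).
have icst p : m.-integrable E (EFin \o cst p).
  apply/integrableP; split.
    by have H := @measurable_cst _ _ _ _ E p%:E; exact: H.
  rewrite (_ : (fun x => _) = cst `|p|%:E)// integral_cst//.
  by rewrite -(fineK fE) -EFinM ltry.
have lo : (k - e) * fine (m E) <= Rintegral m E h.
  rewrite -Rintegral_cst//; apply: le_Rintegral => //; first exact: icst.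
  by move=> x Ex; have := hk x Ex; rewrite ler_norml => /andP[]; lra.
have hi : Rintegral m E h <= (k + e) * fine (m E).
  rewrite -Rintegral_cst//; apply: le_Rintegral => //; first exact: icst.
  by move=> x Ex; have := hk x Ex; rewrite ler_norml => /andP[]; lra.
rewrite mulrBl in lo; rewrite mulrDl in hi.
by rewrite ler_norml; apply/andP; split; lra.
Qed.

Lemma lintegral_near mu E h k e : bounded_borel a b E -> lintegrable mu h ->
  (forall x, E x -> `|h x - k| <= e) ->
  `|fine (lintegral mu h E) - k * fine (lval mu E)| <= e * fine (lvar mu E).
Proof.
move=> bE ih hk; have [ip iN] := lintegrable_pos_neg ih bE.
have [fp fN] := bounded_borel_fin mu bE; have [mE _] := bE.
have Hp := Rintegral_near mE fp ip hk; have HN := Rintegral_near mE fN iN hk.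
rewrite fine_lval// fine_lvar// /lintegral fineB ?integrable_fin_num//.
rewrite [leRHS]mulrDr; set p := fine _ in Hp *; set n := fine _ in HN *.
rewrite (_ : p - n - _ =
  (p - k * fine (lpos mu E)) - (n - k * fine (lneg mu E)));
  last by ring.
by apply: le_trans (ler_normB _ _) _; exact: lerD.
Qed.

Lemma bounded_borel_itv (i : interval R) c d : ooE a b c -> ooE a b d ->
  [set` i] `<=` `[c, d]%classic -> bounded_borel a b [set` i].
Proof.
by move=> abc abd icd; split; [exact: measurable_itv|exists c, d].
Qed.

Lemma bounded_borel_set1 x : ooE a b x -> bounded_borel a b [set x].
Proof.
move=> abx; split; first exact: measurable_set1.
by exists x, x; split=> // y ->; rewrite /= in_itv/= lexx.
Qed.

(** The measure df is specified by left limits of [f] alone, so f^+ has to be recovered as a limit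
    of left limits. *)
Lemma llim_cvg_right f x : regulated a b f -> ooE a b x ->
  llim f y @[y --> x^'+] --> rlim f x.
Proof.
move=> rf abx; apply/cvgrPdist_le => e e0.
have [d d0 Hd] := rlim_dist rf abx e0.
have [c abc xc] := ooE_gt abx.
near=> y.
have xy : x < y by near: y; exact: nbhs_right_gt.
have yd : y < x + d by near: y; apply: nbhs_right_lt; rewrite ltrDl.
have yc : y < c by near: y; exact: nbhs_right_lt.
have aby : ooE a b y := ooE_itv abx abc (ltW xy) (ltW yc).
have H z : x < z -> z < y -> rlim f x - e <= f z <= rlim f x + e.
  move=> xz zy; have := Hd z xz (lt_trans zy yd).
  by rewrite ltr_norml => /andP[] *; apply/andP; split; lra.
rewrite distrC ler_norml; apply/andP; split.
  rewrite lerBrDl.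
  by apply: (llim_ge rf aby xy) => z xz zy; have /andP[] := H z xz zy.
rewrite lerBlDl.
by apply: (llim_le rf aby xy) => z xz zy; have /andP[] := H z xz zy.
Unshelve. all: by end_near. Qed.

Lemma generates_set1 f mu x : regulated a b f -> generates f mu ->
  ooE a b x -> fine (lval mu [set x]) = jump f x.
Proof.
move=> rf gf abx; have [c abc xc] := ooE_gt abx.
(* The intervals [x, y n), on which df is prescribed, shrink to {x}; as y 0 = c, all of them stay
   inside (a, b). Continuity from above is applied to each Jordan part. *)
pose y n : R := x + (c - x) * n.+1%:R^-1.
have xy n : x < y n by rewrite ltrDl mulr_gt0// ?subr_gt0// invr_gt0.
have yc n : y n <= c.
  rewrite /y -lerBrDl ger_pMr ?subr_gt0//.
  by rewrite invf_le1// ler1n.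
have aby n : ooE a b (y n) := ooE_itv abx abc (ltW (xy n)) (yc n).
have cy : y n @[n --> \oo] --> x.
  rewrite -[X in _ --> X]addr0 -[X in _ --> _ + X](mulr0 (c - x)).
  by apply: cvgD; [exact: cvg_cst|apply: cvgMr; exact: cvg_harmonic].
pose F n : set (measurableTypeR R) := `[x, y n[%classic.
have bF n : bounded_borel a b (F n).
  apply: (bounded_borel_itv abx abc) => z /=; rewrite !in_itv/= => /andP[-> zy].
  by rewrite ltW// (lt_le_trans zy).
have capF : \bigcap_n F n = [set x].
  apply/seteqP; split=> [z Fz|z -> n _ /=].
    2: by rewrite /F/= in_itv/= lexx xy.
  apply/eqP; rewrite eq_le; apply/andP; split.
    rewrite -(cvg_lim _ cy)//; apply: limr_ge; first by apply/cvg_ex; exists x.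
    by near=> n; have := Fz n I; rewrite /F/= in_itv/= => /andP[_ /ltW].
  by have := Fz 0%N I; rewrite /F/= in_itv/= => /andP[].
have decF : {homo F : n m / (n <= m)%N >-> (m <= n)%O}.
  move=> n m nm; apply/subsetPset => z.
  rewrite /F/= !in_itv/= => /andP[-> zy] /=.
  apply: lt_le_trans zy _; rewrite lerD2l.
  apply: ler_wpM2l; first by rewrite subr_ge0 ltW.
  by rewrite lef_pV2 ?posrE// ler_nat.
have cvgF (m : {measure set (measurableTypeR R) -> \bar R}) :
    (forall E, bounded_borel a b E -> m E \is a fin_num) ->
    fine (m (F n)) @[n --> \oo] --> fine (m [set x]).
  move=> mfin; apply: fine_cvg; rewrite fineK; last first.
    exact/mfin/bounded_borel_set1.
  rewrite -capF; apply: nonincreasing_cvg_mu => //.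
  - by rewrite ltey_eq mfin.
  - by move=> n; have [] := bF n.
  - by rewrite capF; exact: measurable_set1.
have cp := cvgF (lpos mu) (fun E bE => (bounded_borel_fin mu bE).1).
have cn := cvgF (lneg mu) (fun E bE => (bounded_borel_fin mu bE).2).
rewrite fine_lval; last exact: bounded_borel_set1.
have c1 : fine (lpos mu (F n)) - fine (lneg mu (F n)) @[n --> \oo] -->
    fine (lpos mu [set x]) - fine (lneg mu [set x]) by exact: cvgB cp cn.
have c2 : llim f (y n) - llim f x @[n --> \oo] --> jump f x.
  apply: cvgB; last exact: cvg_cst.
  by have /cvg_at_rightP := llim_cvg_right rf abx; apply.
rewrite -(cvg_lim _ c1)// -(cvg_lim _ c2)//.
by congr (lim (_ @ \oo)); apply/funext => n; rewrite -fine_lval// gf.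
Unshelve. all: by end_near. Qed.

Lemma generates_oo f mu x y : regulated a b f -> generates f mu ->
  ooE a b x -> ooE a b y -> x < y ->
  fine (lval mu `]x, y[%classic) = llim f y - rlim f x.
Proof.
move=> rf gf abx aby xy.
have b1 := bounded_borel_set1 abx.
have bo : bounded_borel a b `]x, y[%classic.
  by apply: (bounded_borel_itv abx aby) => z /=;
    rewrite !in_itv/= => /andP[? ?];
    rewrite !ltW.
have bc : bounded_borel a b `[x, y[%classic.
  by apply: (bounded_borel_itv abx aby) => z /=;
    rewrite !in_itv/= => /andP[-> ?];
    rewrite ltW.
have U (m : {measure set (measurableTypeR R) -> \bar R}) :
    m `[x, y[%classic = (m [set x] + m `]x, y[%classic)%E.
  rewrite -measureU//.
  - congr (m _); apply/esym.
    rewrite (_ : [set x] `|` _ = x |` `]x, y[%classic)//.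
    by rewrite setU1itv// bnd_simp.
  - by apply/seteqP; split=> // z [-> /=]; rewrite in_itv/= ltxx.
have := generates_set1 rf gf abx; have := gf x y abx aby xy.
move=> /(congr1 fine); rewrite !fine_lval//= !U.
have [? ?] := bounded_borel_fin mu b1; have [? ?] := bounded_borel_fin mu bo.
by rewrite !fineD// /jump; lra.
Qed.

(** On (x, y) with y near x, [g] is within e of g^+(x), so the integral is g^+(x) times the
    increment of [al] up to e times the variation of dalpha on (x, y). This variation is the control
    function, superadditive because it omits the atom at a common endpoint. *)
Lemma RN_stieltjes_derivative f g al da df : regulated a b f ->
  regulated a b g -> regulated a b al -> generates al da -> generates f df ->
  lintegrable da g ->
  (forall E, bounded_borel a b E ->
     fine (lval df E) = fine (lintegral da g E)) ->
  stieltjes_derivative a b f g al.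
Proof.
move=> rf rg ral gal gf ig RN; split=> [x abx|].
  have b1 := bounded_borel_set1 abx.
  rewrite -(generates_set1 rf gf abx) -(generates_set1 ral gal abx) RN//.
  apply/eqP; rewrite -subr_eq0 -normr_le0.
  (* On a singleton [g] is constant, so the estimate with e = 0 is an equality. *)
  rewrite -(mul0r (fine (lvar da [set x]))); apply: lintegral_near => //.
  by move=> y ->; rewrite subrr normr0.
have bo x y : ooE a b x -> ooE a b y -> bounded_borel a b `]x, y[%classic.
  move=> abx aby; apply: (bounded_borel_itv abx aby) => z /=.
  by rewrite !in_itv/= => /andP[? ?]; rewrite !ltW.
exists (fun x y => fine (lvar da `]x, y[%classic)); split.
- by move=> x y; exact: fine_ge0.
- move=> x y z abx abz xy yz.
  have aby : ooE a b y := ooE_itv abx abz (ltW xy) (ltW yz).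
  have fv p q : ooE a b p -> ooE a b q ->
      lvar da `]p, q[%classic \is a fin_num.
    move=> abp abq; have [fp fn] := bounded_borel_fin da (bo p q abp abq).
    by rewrite lvarE fin_numD fp.
  rewrite -fineD ?fv//; apply: fine_le; rewrite ?fin_numD ?fv// -measureU.
  + apply: le_measure; rewrite ?inE; [apply: measurableU| |];
      try exact: measurable_itv.
    move=> w [|] /=; rewrite !in_itv/= => /andP[p q].
      by rewrite p (lt_trans q).
    by rewrite q (lt_trans xy).
  + exact: measurable_itv.
  + exact: measurable_itv.
  + apply/seteqP; split=> // w /=;
      rewrite !in_itv/= => -[/andP[_ p] /andP[q _]].
    by have := lt_trans p q; rewrite ltxx.
- move=> x abx e e0; have [d d0 Hd] := rlim_dist rg abx e0.
  exists d => // y aby xy yd.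
  rewrite -(generates_oo rf gf)// -(generates_oo ral gal)// RN; last exact: bo.
  apply: lintegral_near => //; first exact: bo.
  move=> z /=; rewrite in_itv/= => /andP[xz zy]; apply: ltW; apply: Hd => //.
  exact: lt_trans yd.
- move=> x abx e e0; have [d d0 Hd] := llim_dist rg abx e0.
  exists d => // y aby xy yd.
  rewrite -(generates_oo rf gf)// -(generates_oo ral gal)// RN; last exact: bo.
  apply: lintegral_near => //; first exact: bo.
  move=> z /=; rewrite in_itv/= => /andP[xz zy]; apply: ltW; apply: Hd => //.
  exact: lt_trans xz.
Qed.

(** Both equations have the form df = g dalpha, the second with [u] as derivative of [g] along [be].
    Finiteness on bounded Borel sets allows the extended-real identity to be rearranged. *)
Lemma balanced_solutionE r al be u : strictly_increasing a b al ->
  BVloc a b be -> balanced_solution a b r al be u ->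
  exists g, solution a b r al be u g.
Proof.
move=> sal bvbe [[bvu bu] [g [da [db [du [dg [G S]]]]]]].
have [gal gbe gu gg] := G; have [bg RN iu E0] := S.
have [bvg {}bg] := bg; have [_ ig {}RN] := RN.
have ral := strictly_increasing_regulated sal.
have rbe := BVloc_regulated bvbe.
have ru := BVloc_regulated bvu; have rg := BVloc_regulated bvg.
exists g; split; [exact: ru|exact: rg|exact: bu|exact: bg|split].
  by apply: (RN_stieltjes_derivative ru rg ral gal gu ig) => E bE; rewrite RN.
apply: (RN_stieltjes_derivative rg ru rbe gbe gg iu) => E bE.
have [fp fn] := bounded_borel_fin dg bE.
have [ip iN] := lintegrable_pos_neg iu bE; have [mE _] := bE.
have f1 : lval dg E \is a fin_num by rewrite /lval fin_numB fp.
have f2 : lintegral db u E \is a fin_num.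
  by rewrite /lintegral fin_numB !integrable_fin_num.
have := E0 E bE; rewrite -{1}(fineK f1) -{1}(fineK f2).
by rewrite -EFinN -EFinD => -[] /eqP; rewrite addrC subr_eq0 => /eqP ->.
Qed.

End measures.

(** * Normalization of signs *)

Section sign_normalization.
Context (R : realType) (a b : \bar R) (r : R) (al be : R -> R).
Implicit Types (u v g h : R -> R) (s t x : R).

Lemma solutionN u g : solution a b r al be u g ->
  solution a b r al be (fun x => - u x) (fun x => - g x).
Proof.
move=> S; have := solutionD (- 1) 0 S S.
by congr solution; apply/funext => x; rewrite mul0r addr0 mulN1r.
Qed.

Lemma changes_sign_inN v (I : set R) : regulated a b v ->
  changes_sign_in a b (fun x => - v x) I -> changes_sign_in a b v I.
Proof.
move=> rv [x Ix [abx [d [d0 dab H]]]]; exists x => //; split=> //.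
exists d; split=> //.
have inab y : x - d < y -> y < x + d -> ooE a b y.
  by move=> *; apply: dab; rewrite /= in_itv/=; apply/andP.
case: H => -[H1 H2]; [right|left]; split=> y yI.
- have := H1 y yI; move: yI; rewrite in_itv/= => /andP[y1 y2].
  by rewrite (llimN rv) ?oppr_lt0//; apply: inab; lra.
- have := H2 y yI; move: yI; rewrite in_itv/= => /andP[y1 y2].
  by rewrite (rlimN rv) ?oppr_gt0//; apply: inab; lra.
- have := H1 y yI; move: yI; rewrite in_itv/= => /andP[y1 y2].
  by rewrite (llimN rv) ?oppr_gt0//; apply: inab; lra.
- have := H2 y yI; move: yI; rewrite in_itv/= => /andP[y1 y2].
  by rewrite (rlimN rv) ?oppr_lt0//; apply: inab; lra.
Qed.

Lemma sign_changesNv u v s t : regulated a b v ->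
  sign_changes a b r al be u (fun x => - v x) s t ->
  sign_changes a b r al be u v s t.
Proof.
move=> rv [H1 [H2 [H3 [H4 H5]]]]; have N I := @changes_sign_inN v I rv.
by split; [|split; [|split; [|split]]] => *; apply: N;
  [exact: H1|exact: H2|exact: H3|exact: H4|exact: H5].
Qed.

Lemma sign_changesNu u v s t : regulated a b u -> ooE a b s -> ooE a b t ->
  sign_changes a b r al be (fun x => - u x) v s t ->
  sign_changes a b r al be u v s t.
Proof.
move=> ru abs abt; rewrite /sign_changes !(llimN ru)// !(rlimN ru)// !mulrNN.
move=> [H1 [H2 [H3 [H4 H5]]]].
by split; [|split; [|split; [|split]]] => p q; [apply: H1|apply: H2|apply: H3|
  apply: H4|apply: H5] => //; rewrite ?p ?q oppr0.
Qed.

Hypotheses (sal : strictly_increasing a b al).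
Hypothesis theta0 : forall x, ooE a b x ->
  theta al be (1 - r) x != 0 /\ theta al be r x != 0.

(** The product W^- W^+ equals theta_r theta_(1-r) W^2, which has the sign of theta_r /
    theta_(1-r). *)
Lemma wronskian_sign u g v h s t :
  solution a b r al be u g -> solution a b r al be v h ->
  (forall x, ooE a b x -> wronskian u g v h x != 0) ->
  ooE a b s -> ooE a b t -> s < t ->
  (forall x, s < x -> x < t -> 0 < theta_ratio r al be x) ->
  let W := wronskian u g v h in
  (forall x, s < x -> x < t -> 0 < llim W x /\ 0 < rlim W x) \/
  (forall x, s < x -> x < t -> llim W x < 0 /\ rlim W x < 0).
Proof.
move=> Su Sv W0 abs abt st th W.
apply: (constant_sign (regulated_wronskian Su Sv) abs abt st) => x sx xt.
have abx := ooE_itv abs abt (ltW sx) (ltW xt).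
rewrite (llim_wronskian_theta Su Sv abx) (rlim_wronskian_theta Su Sv abx).
have [t1 _] := theta0 abx.
have t2 : 0 < theta al be (1 - r) x ^+ 2 by rewrite exprn_even_gt0.
have thx : 0 < theta al be r x * theta al be (1 - r) x.
  have -> : theta al be r x * theta al be (1 - r) x =
    theta_ratio r al be x * theta al be (1 - r) x ^+ 2.
    by rewrite /theta_ratio expr2 mulrA (divfK t1).
  exact: mulr_gt0 (th x sx xt) t2.
rewrite mulrACA -expr2 [theta _ _ (1 - r) x * _]mulrC mulr_gt0//.
by rewrite exprn_even_gt0//= W0.
Qed.

Lemma sign_changes_of_pos u g v h s t :
  solution a b r al be u g -> solution a b r al be v h ->
  (forall x, ooE a b x -> wronskian u g v h x != 0) ->
  ooE a b s -> ooE a b t -> s < t ->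
  (forall x, s < x -> x < t -> 0 < theta_ratio r al be x) ->
  (forall x, s < x -> x < t -> 0 < llim u x /\ 0 < rlim u x) ->
  sign_changes a b r al be u v s t.
Proof.
move=> Su Sv W0 abs abt st th u0; have [rv rh _ _ _] := Sv.
have [W|W] := wronskian_sign Su Sv W0 abs abt st th.
  exact: (sign_changes_of_gt0 sal Su Sv W0 abs abt st u0 W theta0).
(* When W is negative on (s, t), passing to [- v] makes it positive. *)
apply: (sign_changesNv rv).
apply: (sign_changes_of_gt0 sal Su (solutionN Sv) _ abs abt st u0 _ theta0).
  by move=> x abx; rewrite /wronskian !mulrN -opprD oppr_eq0 W0.
have -> : wronskian u g (fun x => - v x) (fun x => - h x) =
    fun x => - wronskian u g v h x.
  by apply/funext => x; rewrite /wronskian !mulrN opprD.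
move=> x sx xt; have abx := ooE_itv abs abt (ltW sx) (ltW xt).
rewrite (llimN (regulated_wronskian Su Sv))//.
by rewrite (rlimN (regulated_wronskian Su Sv))// !oppr_gt0; exact: W.
Qed.

End sign_normalization.

Theorem theorem5p5 (R : realType) (a b : \bar R) (hab : (a < b)%E)
  (r : R) (r_ge0 : 0 <= r) (r_le1 : r <= 1)
  (alpha : R -> R) (halpha : strictly_increasing a b alpha)
  (beta : R -> R) (hbeta : BVloc a b beta)
  (htheta : forall x : R, ooE a b x ->
     theta alpha beta (1 - r) x != 0 /\ theta alpha beta r x != 0)
  (u v : R -> R)
  (hu : balanced_solution a b r alpha beta u)
  (hv : balanced_solution a b r alpha beta v)
  (huv : lin_indep a b u v)
  (s t : R) (hst : consecutive_zeros a b u s t)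
  (hpos : forall x : R, s < x -> x < t -> 0 < theta_ratio r alpha beta x) :
  (llim u s * rlim u s < 0 -> llim u t = 0 ->
   0 < theta alpha beta r s ->
   changes_sign_in a b v `[s, t[%classic) /\
  (rlim u s = 0 -> llim u t * rlim u t < 0 ->
   0 < theta alpha beta (1 - r) t ->
   changes_sign_in a b v `]s, t]%classic) /\
  (llim u s * rlim u s < 0 -> rlim u t = 0 ->
   0 < theta alpha beta r s * theta alpha beta (1 - r) t ->
   changes_sign_in a b v `[s, t]%classic) /\
  (llim u s = 0 -> llim u t * rlim u t < 0 ->
   0 < theta alpha beta r s * theta alpha beta (1 - r) t ->
   changes_sign_in a b v `[s, t]%classic) /\
  (llim u s * rlim u s < 0 -> llim u t * rlim u t < 0 ->
   0 < theta alpha beta r s * theta alpha beta (1 - r) t ->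
   changes_sign_in a b v `[s, t]%classic).
Proof.
have [[abs _] [abt _] st Z] := hst.
have bval : BVloc a b alpha.
  by apply: monotone_BVloc => x y; exact: strictly_increasing_le.
have [g Su] := balanced_solutionE halpha hbeta hu.
have [h Sv] := balanced_solutionE halpha hbeta hv.
have W0 := fun x => @wronskian_neq0 R a b r alpha beta r_ge0 r_le1 bval hbeta
  htheta u g v h x Su Sv huv.
have [ru _ _ _ _] := Su; have [rv _ _ _ _] := Sv.
have u_sign : forall x, s < x -> x < t -> 0 < llim u x * rlim u x.
  move=> x sx xt; rewrite ltNge; apply/negP => ux.
  suff : set0 x by [].
  rewrite -Z; split; last by rewrite /= in_itv/= sx.
  by split=> //; exact: ooE_itv abs abt (ltW sx) (ltW xt).
have itv x : s < x -> x < t -> ooE a b x.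
  by move=> sx xt; exact: ooE_itv abs abt (ltW sx) (ltW xt).
have [u0|u0] := constant_sign ru abs abt st u_sign.
  exact: (sign_changes_of_pos halpha htheta Su Sv W0 abs abt st hpos u0).
apply: (sign_changesNu ru abs abt).
apply: (sign_changes_of_pos halpha htheta (solutionN Su) Sv _ abs abt st hpos).
  by move=> x abx; rewrite /wronskian !mulNr -opprD oppr_eq0 W0.
move=> x sx xt; have abx := itv x sx xt.
by rewrite (llimN ru abx) (rlimN ru abx) !oppr_gt0; exact: u0.
Qed.
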